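(* In the Euclidean plane or space, let ${\rm O},{\rm A},{\rm B}$ be three distinct points such that ${\rm O}$ does not lie on the segment ${\rm A}{\rm B}$. For every $T>0$ there is a unique direct Keplerian arc around ${\rm O}$ and a unique simple indirect Keplerian arc around ${\rm O}$ going from ${\rm A}$ to ${\rm B}$ with elapsed time $T$.
   Context: Kepler problem normalized as $\ddot q=-q/|q|^3$, fixed center ${\rm O}$. A Keplerian arc from ${\rm A}$ to ${\rm B}$ is a solution on a compact time interval $[t_{\rm A},t_{\rm B}]$, $t_{\rm A}<t_{\rm B}$, with $q(t_{\rm A})={\rm A}$, $q(t_{\rm B})={\rm B}$; elapsed time $t_{\rm B}-t_{\rm A}$. Rectilinear motions are extended after collision with ${\rm O}$ (bounce back along the same ray with the same energy). An arc is indirect if its convex hull contains ${\rm O}$, direct otherwise. An indirect arc is multi-revolution if the orbit is periodic and the elapsed time exceeds a period, and simple otherwise. *)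

(* Defs.v *)
From Stdlib Require Import Reals Lra.
Open Scope R_scope.

(* Points/vectors of R^d are represented as functions nat -> R whose
   coordinates of index >= d vanish. The fixed center O is the origin. *)
Definition Vec := nat -> R.

Definition InSpace (d : nat) (x : Vec) : Prop := forall i, (d <= i)%nat -> x i = 0.

Definition veq (x y : Vec) : Prop := forall i, x i = y i.

Fixpoint vsum (n : nat) (f : nat -> R) : R :=
  match n with
  | O => 0
  | S m => vsum m f + f m
  end.

Definition vnorm (d : nat) (x : Vec) : R := sqrt (vsum d (fun i => (x i) ^ 2)).

Definition KeplerRegular (d : nat) (a b : R) (q : R -> Vec) : Prop :=
  exists v : R -> Vec,
    forall t, a <= t <= b ->
      InSpace d (q t) /\ vnorm d (q t) <> 0 /\
      forall i, (i < d)%nat ->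
        derivable_pt_lim (fun s => q s i) t (v t i) /\
        derivable_pt_lim (fun s => v s i) t (- q t i / (vnorm d (q t)) ^ 3).

(* Rectilinear motion along a fixed ray q = r u (|u| = 1, r >= 0), with
   r'' = -1/r^2 off collisions, isolated collisions, and the same energy h
   before and after each collision (bounce back along the same ray). *)
Definition KeplerRectilinear (d : nat) (a b : R) (q : R -> Vec) : Prop :=
  exists (u : Vec) (r rd : R -> R) (h : R),
    InSpace d u /\ vnorm d u = 1 /\
    forall t, a <= t <= b ->
      (forall i, q t i = r t * u i) /\
      0 <= r t /\ continuity_pt r t /\
      (0 < r t ->
         derivable_pt_lim r t (rd t) /\
         derivable_pt_lim rd t (- 1 / (r t) ^ 2) /\
         (rd t) ^ 2 / 2 - 1 / r t = h) /\
      (r t = 0 ->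
         exists eps, 0 < eps /\
           forall s, a <= s <= b -> 0 < Rabs (s - t) < eps -> r s <> 0).

Definition KeplerArc (d : nat) (a b : R) (q : R -> Vec) : Prop :=
  a < b /\ (KeplerRegular d a b q \/ KeplerRectilinear d a b q).

Definition HullContainsO (d : nat) (a b : R) (q : R -> Vec) : Prop :=
  exists (n : nat) (w tau : nat -> R),
    (forall k, (k < n)%nat -> 0 <= w k /\ a <= tau k <= b) /\
    vsum n w = 1 /\
    forall i, vsum n (fun k => w k * q (tau k) i) = 0.

Definition Indirect (d : nat) (a b : R) (q : R -> Vec) : Prop := HullContainsO d a b q.
Definition Direct (d : nat) (a b : R) (q : R -> Vec) : Prop := ~ HullContainsO d a b q.

Definition MultiRevolution (d : nat) (a b : R) (q : R -> Vec) : Prop :=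
  Indirect d a b q /\
  exists P, 0 < P < b - a /\
    forall t, a <= t -> t + P <= b -> veq (q (t + P)) (q t).

Definition SimpleIndirect (d : nat) (a b : R) (q : R -> Vec) : Prop :=
  Indirect d a b q /\ ~ MultiRevolution d a b q.

(* Keplerian arc from A to B with elapsed time T (time origin fixed at 0,
   the problem being autonomous). *)
Definition ArcFromTo (d : nat) (A B : Vec) (T : R) (q : R -> Vec) : Prop :=
  KeplerArc d 0 T q /\ veq (q 0) A /\ veq (q T) B.

(* Main.v *)
Require Import Defs.
From Stdlib Require Import Reals Lra Lia Psatz FunctionalExtensionality ClassicalEpsilon.
From Coquelicot Require Import Coquelicot.
Open Scope R_scope.

(* Sundman's fictitious time [s], with [dt = |q| ds], makes the motion of energy [h = - 2 l] linear, and
   along any arc it is given explicitly by [s = q.q' - q0.q0' - 2 h t], which stays continuous through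
   collisions. With Levi-Civita's square root [q = z^2] one has [z'' = - l z]; an arc of less than one
   period joins a fixed square root [a] of [A] to one of the two square roots [b] of [B], and it is direct
   when [k = a.b > 0], simple indirect when [k < 0]. As [2 k^2 = |A||B| + A.B] and [ab] is a multiple of
   [|B| A + |A| B], all this can be said without complex numbers, in any dimension, rectilinear arcs
   included.

   Put [m = |A| + |B|], [mu = m + 2 k], [nu = m - 2 k]. If [sh] is half of the fictitious time of the arc,
   [D = sin (sqrt l * sh) / sqrt l] and [th = l D^2 < 1], then [2 D^2 = nu + mu th / (1 - th)] and
     [T = mu D / (2 sqrt (1 - th)) + D^3 * int_0^1 y^2 / sqrt (1 - th y^2) dy].
   Every term increases with [th], and [T] ranges over all positive numbers, so [T] and the sign of [k]
   determine the arc. *)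

(** * The linear oscillator [x'' = - l x] *)

(* [auto_derive] for terms in which the derivatives of some functions are given by hypotheses. *)
Ltac derive_using :=
  cbv beta; auto_derive;
  [ repeat split; first [ eexists; eassumption | lra | idtac ]
  | repeat match goal with |- context [Derive ?f ?x] =>
      let E := fresh in
      eassert (E : Derive f x = _) by (apply is_derive_unique; eassumption);
      rewrite E; clear E end ].

(** With [q = z^2], energy [- 2 l] becomes the oscillator energy [|z'|^2 + l |z|^2 = 1/2]. Writing
    the initial [z'] as [(b - a cos) / sin], with the oscillator functions taken at the end of the
    arc, gives the chord relation [m - 2 k cos = sin^2 / 2]; half-angle formulas turn it into the
    relation between [D] and [th]. Elliptic, parabolic and hyperbolic motions are merged by letting
    [osc_cos] and [osc_sin] accept any real [l]: the identities are then polynomial ones modulo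
    [osc_cos^2 + l osc_sin^2 = 1]. Two obstacles shape the rest. The equation of motion fails at
    collisions, so the linear formula has to be recovered from continuity and from validity off
    isolated instants. And an indirect arc is multi-revolution as soon as its positions repeat after
    some [P], so every repetition within less than a period has to be excluded. *)

Definition osc_cos (l s : R) : R :=
  match total_order_T l 0 with
  | inleft (left _) => cosh (sqrt (- l) * s)
  | inleft (right _) => 1
  | inright _ => cos (sqrt l * s)
  end.

Definition osc_sin (l s : R) : R :=
  match total_order_T l 0 with
  | inleft (left _) => sinh (sqrt (- l) * s) / sqrt (- l)
  | inleft (right _) => s
  | inright _ => sin (sqrt l * s) / sqrt l
  end.

(** The antiderivative of [osc_sin l ^ 2 / 2] that vanishes at 0; the value at [l = 0] is the limit
    of the other formula. *)
Definition osc_vol (l s : R) : R :=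
  match total_order_T l 0 with
  | inleft (right _) => s ^ 3 / 6
  | _ => (s - osc_cos l s * osc_sin l s) / (4 * l)
  end.

Lemma osc_cos_0 l : osc_cos l 0 = 1.
Proof.
unfold osc_cos; destruct (total_order_T l 0) as [[H|H]|H]; try easy;
 rewrite Rmult_0_r; [apply cosh_0|apply cos_0].
Qed.

Lemma osc_sin_0 l : osc_sin l 0 = 0.
Proof.
unfold osc_sin; destruct (total_order_T l 0) as [[H|H]|H]; try easy;
 rewrite Rmult_0_r, ?sinh_0, ?sin_0; unfold Rdiv; ring.
Qed.

Lemma osc_vol_0 l : osc_vol l 0 = 0.
Proof.
unfold osc_vol; rewrite osc_sin_0; destruct (total_order_T l 0) as [[H|H]|H];
  field; lra.
Qed.

Lemma is_derive_cosh x : is_derive cosh x (sinh x).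
Proof. apply is_derive_Reals, derivable_pt_lim_cosh. Qed.
Lemma is_derive_sinh x : is_derive sinh x (cosh x).
Proof. apply is_derive_Reals, derivable_pt_lim_sinh. Qed.

Lemma is_derive_osc_cos (l s : R) : is_derive (osc_cos l) s (- l * osc_sin l s).
Proof.
unfold osc_cos, osc_sin; destruct (total_order_T l 0) as [[H|H]|H].
- assert (Hs : 0 < sqrt (- l)) by (apply sqrt_lt_R0; lra).
  assert (E : sqrt (- l) * sqrt (- l) = - l) by (apply sqrt_sqrt; lra).
  evar_last.
  { apply (is_derive_comp cosh (fun s => sqrt (-l) * s)); [apply is_derive_cosh|].
    auto_derive; [exact I|reflexivity]. }
  unfold scal; simpl; unfold mult; simpl. rewrite <- E at 3; field; lra.
- subst l; evar_last; [apply is_derive_const|]. unfold zero; simpl; ring.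
- assert (Hs : 0 < sqrt l) by (apply sqrt_lt_R0; lra).
  assert (E : sqrt l * sqrt l = l) by (apply sqrt_sqrt; lra).
  auto_derive; [exact I|]. rewrite <- E at 3; field; lra.
Qed.

Lemma is_derive_osc_sin (l s : R) : is_derive (osc_sin l) s (osc_cos l s).
Proof.
unfold osc_cos, osc_sin; destruct (total_order_T l 0) as [[H|H]|H].
- assert (Hs : 0 < sqrt (- l)) by (apply sqrt_lt_R0; lra).
  apply (is_derive_ext (fun s => / sqrt (- l) * sinh (sqrt (- l) * s))).
  { intros t; unfold Rdiv; apply Rmult_comm. }
  evar_last.
  { apply is_derive_scal, (is_derive_comp sinh (fun s => sqrt (-l) * s)); [apply is_derive_sinh|].
    auto_derive; [exact I|reflexivity]. }
  unfold scal; simpl; unfold mult; simpl. field; lra.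
- auto_derive; [exact I|reflexivity].
- assert (Hs : 0 < sqrt l) by (apply sqrt_lt_R0; lra).
  auto_derive; [exact I|]. field; lra.
Qed.

Lemma osc_pythagoras l s : osc_cos l s ^ 2 + l * osc_sin l s ^ 2 = 1.
Proof.
unfold osc_cos, osc_sin; destruct (total_order_T l 0) as [[H|H]|H].
- assert (Hs : 0 < sqrt (- l)) by (apply sqrt_lt_R0; lra).
  assert (E : sqrt (- l) * sqrt (- l) = - l) by (apply sqrt_sqrt; lra).
  set (w := sqrt (-l)) in *. replace l with (- (w * w)) by lra.
  replace (- (w * w) * (sinh (w * s) / w) ^ 2) with (- sinh (w * s) ^ 2) by (field; lra).
  unfold cosh, sinh; rewrite exp_Ropp; field. apply Rgt_not_eq, exp_pos.
- subst; ring.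
- assert (Hs : 0 < sqrt l) by (apply sqrt_lt_R0; lra).
  assert (E : sqrt l * sqrt l = l) by (apply sqrt_sqrt; lra).
  set (w := sqrt l) in *. rewrite <- E.
  replace (w * w * (sin (w * s) / w) ^ 2) with (sin (w * s) ^ 2) by (field; lra).
  rewrite Rplus_comm, <- !Rsqr_pow2; apply sin2_cos2.
Qed.

Lemma is_derive_osc_vol (l s : R) : is_derive (osc_vol l) s (osc_sin l s ^ 2 / 2).
Proof.
assert (G : forall l : R, l <> 0 ->
  is_derive (fun s => (s - osc_cos l s * osc_sin l s) / (4 * l)) s (osc_sin l s ^ 2 / 2)).
{ clear; intros l Hl.
  generalize (osc_pythagoras l s) (is_derive_osc_cos l s) (is_derive_osc_sin l s); intros E Hc Hs.
  derive_using.
  transitivity ((1 - (osc_cos l s ^ 2 - l * osc_sin l s ^ 2)) / (4 * l)); [|rewrite <- E]; field; easy. }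
unfold osc_vol; destruct (total_order_T l 0) as [[H|H]|H].
- apply G; lra.
- unfold osc_sin; destruct (total_order_T l 0) as [[H'|H']|H']; try lra.
  auto_derive; [exact I|field].
- apply G; lra.
Qed.

Lemma osc_sin_minus l x y :
  osc_sin l (x - y) = osc_sin l x * osc_cos l y - osc_cos l x * osc_sin l y.
Proof.
unfold osc_cos, osc_sin; destruct (total_order_T l 0) as [[H|H]|H].
- assert (Hs : 0 < sqrt (- l)) by (apply sqrt_lt_R0; lra).
  set (w := sqrt (-l)) in *. unfold cosh, sinh.
  replace (- (w * (x - y))) with (- (w * x) + w * y) by ring.
  replace (w * (x - y)) with (w * x + - (w * y)) by ring.
  rewrite !exp_plus, !exp_Ropp; field.
  repeat split; try lra; apply Rgt_not_eq, exp_pos.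
- ring.
- assert (Hs : 0 < sqrt l) by (apply sqrt_lt_R0; lra).
  rewrite Rmult_minus_distr_l, sin_minus; field; lra.
Qed.

Lemma osc_cos_minus l x y :
  osc_cos l (x - y) = osc_cos l x * osc_cos l y + l * osc_sin l x * osc_sin l y.
Proof.
unfold osc_cos, osc_sin; destruct (total_order_T l 0) as [[H|H]|H].
- assert (Hs : 0 < sqrt (- l)) by (apply sqrt_lt_R0; lra).
  assert (E : sqrt (- l) * sqrt (- l) = - l) by (apply sqrt_sqrt; lra).
  set (w := sqrt (-l)) in *. replace l with (- (w * w)) by lra.
  replace (- (w * w) * (sinh (w * x) / w) * (sinh (w * y) / w))
    with (- sinh (w * x) * sinh (w * y)) by (field; lra).
  unfold cosh, sinh.
  replace (- (w * (x - y))) with (- (w * x) + w * y) by ring.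
  replace (w * (x - y)) with (w * x + - (w * y)) by ring.
  rewrite !exp_plus, !exp_Ropp; field.
  repeat split; try lra; apply Rgt_not_eq, exp_pos.
- subst; ring.
- assert (Hs : 0 < sqrt l) by (apply sqrt_lt_R0; lra).
  assert (E : sqrt l * sqrt l = l) by (apply sqrt_sqrt; lra).
  set (w := sqrt l) in *. rewrite Rmult_minus_distr_l, cos_minus, <- E. field; lra.
Qed.

Lemma osc_sin_opp l s : osc_sin l (- s) = - osc_sin l s.
Proof.
replace (- s) with (0 - s) by ring.
rewrite osc_sin_minus, osc_sin_0, osc_cos_0; ring.
Qed.

Lemma osc_cos_opp l s : osc_cos l (- s) = osc_cos l s.
Proof.
replace (- s) with (0 - s) by ring.
rewrite osc_cos_minus, osc_sin_0, osc_cos_0; ring.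
Qed.

Lemma osc_sin_plus l x y :
  osc_sin l (x + y) = osc_sin l x * osc_cos l y + osc_cos l x * osc_sin l y.
Proof.
replace (x + y) with (x - - y) by ring.
rewrite osc_sin_minus, osc_cos_opp, osc_sin_opp; ring.
Qed.

Lemma osc_cos_plus l x y :
  osc_cos l (x + y) = osc_cos l x * osc_cos l y - l * osc_sin l x * osc_sin l y.
Proof.
replace (x + y) with (x - - y) by ring.
rewrite osc_cos_minus, osc_cos_opp, osc_sin_opp; ring.
Qed.

(* [subperiod l s] says that [s] is less than a period of [s |-> q (s)], i.e. half a period of the oscillator. *)
Definition subperiod (l s : R) : Prop := 0 < l -> s < PI / sqrt l.

Lemma osc_sin_pos l s : subperiod l s -> 0 < s -> 0 < osc_sin l s.
Proof.
unfold subperiod, osc_sin; intros H Hs; destruct (total_order_T l 0) as [[Hl|Hl]|Hl].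
- assert (Hw : 0 < sqrt (- l)) by (apply sqrt_lt_R0; lra).
  apply Rdiv_lt_0_compat; [|easy]. rewrite <- sinh_0. apply sinh_lt. nra.
- easy.
- assert (Hw : 0 < sqrt l) by (apply sqrt_lt_R0; lra).
  apply Rdiv_lt_0_compat; [|easy]. specialize (H Hl).
  apply sin_gt_0; [nra|]. apply (Rmult_lt_compat_l (sqrt l)) in H; [|easy].
  replace (sqrt l * (PI / sqrt l)) with PI in H by (field; lra). easy.
Qed.

Lemma cosh_pos x : 0 < cosh x.
Proof. unfold cosh; generalize (exp_pos x) (exp_pos (-x)); lra. Qed.

Lemma osc_cos_pos l s : subperiod l (2 * s) -> 0 <= s -> 0 < osc_cos l s.
Proof.
unfold subperiod, osc_cos; intros H Hs; destruct (total_order_T l 0) as [[Hl|Hl]|Hl].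
- apply cosh_pos.
- lra.
- assert (Hw : 0 < sqrt l) by (apply sqrt_lt_R0; lra). specialize (H Hl).
  apply (Rmult_lt_compat_l (sqrt l)) in H; [|easy].
  replace (sqrt l * (PI / sqrt l)) with PI in H by (field; lra).
  generalize PI_RGT_0; intro. apply cos_gt_0; nra.
Qed.

Lemma osc_half_period l : 0 < l ->
  osc_cos l (PI / sqrt l) = -1 /\ osc_sin l (PI / sqrt l) = 0.
Proof.
intros Hl. unfold osc_cos, osc_sin; destruct (total_order_T l 0) as [[H|H]|H]; try lra.
assert (Hw : 0 < sqrt l) by (apply sqrt_lt_R0; lra).
replace (sqrt l * (PI / sqrt l)) with PI by (field; lra).
rewrite cos_PI, sin_PI; split; [easy|unfold Rdiv; ring].
Qed.

Lemma osc_vol_half_period l s : 0 < l ->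
  osc_vol l (s + PI / sqrt l) = osc_vol l s + osc_vol l (PI / sqrt l).
Proof.
intros Hl. destruct (osc_half_period l Hl) as [E1 E2].
unfold osc_vol; destruct (total_order_T l 0) as [[H|H]|H]; try lra.
assert (Hw : 0 < sqrt l) by (apply sqrt_lt_R0; lra).
rewrite osc_cos_plus, osc_sin_plus, E1, E2; field; lra.
Qed.

Lemma osc_arcsin l d : 0 < d -> l * d ^ 2 < 1 ->
  exists s, 0 < s /\ subperiod l (2 * s) /\ osc_sin l s = d.
Proof.
intros Hd H. unfold subperiod, osc_sin; destruct (total_order_T l 0) as [[Hl|Hl]|Hl].
- assert (Hw : 0 < sqrt (- l)) by (apply sqrt_lt_R0; lra).
  exists (arcsinh (sqrt (-l) * d) / sqrt (-l)); split; [|split; [lra|]].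
  + apply Rdiv_lt_0_compat; [|easy]. rewrite <- arcsinh_0. apply arcsinh_lt. nra.
  + replace (sqrt (- l) * (arcsinh (sqrt (- l) * d) / sqrt (- l))) with (arcsinh (sqrt (- l) * d))
      by (field; lra).
    rewrite sinh_arcsinh; field; lra.
- exists d; repeat split; lra.
- assert (Hw : 0 < sqrt l) by (apply sqrt_lt_R0; lra).
  assert (E : sqrt l * sqrt l = l) by (apply sqrt_sqrt; lra).
  assert (H1 : 0 < sqrt l * d < 1).
  { split; [nra|]. apply Rnot_le_lt; intro Hc. nra. }
  exists (asin (sqrt l * d) / sqrt l); split; [|split].
  + apply Rdiv_lt_0_compat; [|easy]. apply Rnot_le_lt; intro Hc.
    generalize PI_RGT_0 (asin_bound_lt (sqrt l * d) ltac:(lra)) (sin_asin (sqrt l * d) ltac:(lra)).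
    intros HPI Hb Hsin. assert (0 <= sin (- asin (sqrt l * d))) by (apply sin_ge_0; lra).
    rewrite sin_neg in *; lra.
  + intros _. replace (2 * (asin (sqrt l * d) / sqrt l)) with ((2 * asin (sqrt l * d)) / sqrt l)
      by (field; lra).
    apply Rmult_lt_compat_r; [now apply Rinv_0_lt_compat|].
    generalize (asin_bound_lt (sqrt l * d) ltac:(lra)); lra.
  + replace (sqrt l * (asin (sqrt l * d) / sqrt l)) with (asin (sqrt l * d))
      by (field; lra).
    rewrite sin_asin; [field|]; lra.
Qed.

(** * The time of flight as an integral *)

(** Kept as an integral, since a closed form would change with the sign of [th], whereas
    monotonicity, continuity and bounds can be read off the integrand. *)
Definition arc_int (th : R) : R := RInt (fun y => y ^ 2 / sqrt (1 - th * y ^ 2)) 0 1.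

Lemma arc_int_arg_pos th y : th < 1 -> 0 <= y <= 1 -> 0 < 1 - th * y ^ 2.
Proof. intros. assert (0 <= y ^ 2 <= 1) by nra. destruct (Rle_dec th 0); nra. Qed.

Lemma continuous_arc_int_fun th y : 0 < 1 - th * y ^ 2 ->
  continuous (fun y => y ^ 2 / sqrt (1 - th * y ^ 2)) y.
Proof.
intros H; apply (ex_derive_continuous (V := R_NormedModule)). auto_derive.
repeat split; [lra|]. apply Rgt_not_eq, sqrt_lt_R0; lra.
Qed.

Lemma ex_RInt_arc_int th : th < 1 -> ex_RInt (fun y => y ^ 2 / sqrt (1 - th * y ^ 2)) 0 1.
Proof.
intros H; apply (ex_RInt_continuous (V := R_CompleteNormedModule)); intros y Hy.
rewrite Rmin_left, Rmax_right in Hy by lra.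
now apply continuous_arc_int_fun, arc_int_arg_pos.
Qed.

Lemma arc_int_le th1 th2 : th1 <= th2 -> th2 < 1 -> arc_int th1 <= arc_int th2.
Proof.
intros H1 H2; apply RInt_le; [lra|apply ex_RInt_arc_int; lra..|].
intros y Hy. apply Rmult_le_compat_l; [nra|].
apply Rinv_le_contravar; [apply sqrt_lt_R0, arc_int_arg_pos; lra|].
apply sqrt_le_1_alt; nra.
Qed.

Lemma arc_int_ge_0 th : th < 1 -> 0 <= arc_int th.
Proof.
intros H; apply RInt_ge_0; [lra|now apply ex_RInt_arc_int|].
intros y Hy. apply Rdiv_le_0_compat; [nra|]. apply sqrt_lt_R0, arc_int_arg_pos; lra.
Qed.

(** From [1 - th y^2 >= - th y^2] the integrand is at most [y / sqrt (- th)]. This makes the time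
    small as [th] tends to minus infinity. *)
Lemma arc_int_le_inv_sqrt th : th < 0 -> arc_int th <= / sqrt (- th).
Proof.
intros H.
assert (Hs : 0 < sqrt (- th)) by (apply sqrt_lt_R0; lra).
apply Rle_trans with (RInt (fun _ => / sqrt (- th)) 0 1).
2:{ rewrite RInt_const; unfold scal; simpl; unfold mult; simpl; lra. }
apply RInt_le; [lra|apply ex_RInt_arc_int; lra|apply ex_RInt_const|].
intros y Hy.
apply Rle_trans with (y ^ 2 / (sqrt (- th) * y)).
- apply Rmult_le_compat_l; [nra|]. apply Rinv_le_contravar; [nra|].
  rewrite <- (sqrt_Rsqr y) at 1 by lra.
  rewrite <- sqrt_mult; [|lra|apply Rle_0_sqr]. apply sqrt_le_1_alt. unfold Rsqr; nra.
- replace (y ^ 2 / (sqrt (- th) * y)) with (y * / sqrt (- th)) by (field; lra).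
  assert (0 < / sqrt (- th)) by (now apply Rinv_0_lt_compat). nra.
Qed.

Lemma inv_lipschitz m x y : 0 < m -> m <= x -> m <= y ->
  Rabs (/ x - / y) <= Rabs (x ^ 2 - y ^ 2) / (2 * m ^ 3).
Proof.
intros Hm Hx Hy.
assert (Hp : 0 < x * y * (x + y)) by (apply Rmult_lt_0_compat; nra).
replace (/ x - / y) with (- ((x ^ 2 - y ^ 2) / (x * y * (x + y)))) by (field; lra).
rewrite Rabs_Ropp. unfold Rdiv at 1; rewrite Rabs_mult.
apply Rmult_le_compat_l; [apply Rabs_pos|].
rewrite Rabs_pos_eq by (left; now apply Rinv_0_lt_compat).
assert (0 < m ^ 3) by (now apply pow_lt).
apply Rinv_le_contravar; [lra|].
replace (2 * m ^ 3) with (m * m * (m + m)) by ring.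
repeat apply Rmult_le_compat; nra.
Qed.

Lemma continuity_pt_arc_int th : th < 1 -> continuity_pt arc_int th.
Proof.
(* [m] bounds [sqrt (1 - t y^2)] from below for all [y] in [0, 1] and [t <= (1 + th) / 2]: there
   [1 - t y^2] is at least 1 if [t <= 0] and at least [(1 - th) / 2] otherwise. *)
intros H. set (m := sqrt (Rmin 1 ((1 - th) / 2))).
assert (Hm0 : 0 < Rmin 1 ((1 - th) / 2)) by (apply Rmin_pos; lra).
assert (Hm : 0 < m) by (now apply sqrt_lt_R0).
assert (Hm3 : 0 < m ^ 3) by (now apply pow_lt).
assert (L : forall t y, t <= (1 + th) / 2 -> 0 <= y <= 1 -> m <= sqrt (1 - t * y ^ 2)).
{ intros t y Ht Hy. apply sqrt_le_1_alt. assert (0 <= y ^ 2 <= 1) by nra.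
  destruct (Rle_dec t 0) as [Ht0|Ht0];
   [eapply Rle_trans; [apply Rmin_l|nra]|eapply Rle_trans; [apply Rmin_r|nra]]. }
intros e He. exists (Rmin ((1 - th) / 2) (e * m ^ 3)); split; [apply Rmin_pos; nra|].
intros t [_ Ht]; simpl in *; unfold R_dist in *.
assert (Ht1 : Rabs (t - th) < (1 - th) / 2) by (eapply Rlt_le_trans; [exact Ht|apply Rmin_l]).
assert (Ht2 : Rabs (t - th) < e * m ^ 3) by (eapply Rlt_le_trans; [exact Ht|apply Rmin_r]).
apply Rabs_def2 in Ht1.
assert (Ha := ex_RInt_arc_int th H). assert (Hb := ex_RInt_arc_int t ltac:(lra)).
unfold arc_int. rewrite <- (RInt_minus (V := R_CompleteNormedModule)) by easy.
apply Rle_lt_trans with ((1 - 0) * (Rabs (t - th) / (2 * m ^ 3))).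
- apply abs_RInt_le_const; [lra|now apply (ex_RInt_minus (V := R_NormedModule))|].
  intros y Hy.
  change (Rabs (y ^ 2 / sqrt (1 - t * y ^ 2) - y ^ 2 / sqrt (1 - th * y ^ 2))
          <= Rabs (t - th) / (2 * m ^ 3)).
  replace (y ^ 2 / sqrt (1 - t * y ^ 2) - y ^ 2 / sqrt (1 - th * y ^ 2))
    with (y ^ 2 * (/ sqrt (1 - t * y ^ 2) - / sqrt (1 - th * y ^ 2))) by (unfold Rdiv; ring).
  assert (Hy2 : 0 <= y ^ 2 <= 1) by nra.
  rewrite Rabs_mult, (Rabs_pos_eq (y ^ 2)) by lra.
  rewrite <- (Rmult_1_l (Rabs (t - th) / _)).
  apply Rmult_le_compat; [lra|apply Rabs_pos|lra|].
  eapply Rle_trans; [apply (inv_lipschitz m); [easy|apply L; lra..]|].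
  apply Rmult_le_compat_r; [left; apply Rinv_0_lt_compat; lra|].
  rewrite !pow2_sqrt by (left; apply arc_int_arg_pos; lra).
  replace (1 - t * y ^ 2 - (1 - th * y ^ 2)) with (- (t - th) * y ^ 2) by ring.
  rewrite Rabs_mult, Rabs_Ropp, (Rabs_pos_eq (y ^ 2)) by lra.
  generalize (Rabs_pos (t - th)); nra.
- replace ((1 - 0) * (Rabs (t - th) / (2 * m ^ 3))) with (Rabs (t - th) / (2 * m ^ 3)) by ring.
  apply Rlt_div_l; [lra|]. nra.
Qed.

(* The substitution [y = osc_sin l x / osc_sin l s] turns [osc_vol] into [arc_int]. *)
Lemma arc_int_osc l s : 0 < s -> subperiod l (2 * s) ->
  osc_sin l s ^ 3 * arc_int (l * osc_sin l s ^ 2) = 2 * osc_vol l s.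
Proof.
intros Hs Hp. set (d := osc_sin l s).
assert (Hd : 0 < d).
{ apply osc_sin_pos; [|easy]. intros Hl; specialize (Hp Hl); lra. }
assert (Cpos : forall x, 0 <= x <= s -> 0 < osc_cos l x).
{ intros x Hx. apply osc_cos_pos; [|lra]. intros Hl; specialize (Hp Hl); lra. }
assert (E : forall x, 1 - l * d ^ 2 * (osc_sin l x / d) ^ 2 = osc_cos l x ^ 2).
{ intros x. generalize (osc_pythagoras l x). intro.
  replace (l * d ^ 2 * (osc_sin l x / d) ^ 2) with (l * osc_sin l x ^ 2) by (field; lra). lra. }
assert (H := is_RInt_comp (V := R_CompleteNormedModule)
  (fun y => y ^ 2 / sqrt (1 - l * d ^ 2 * y ^ 2)) (fun x => osc_sin l x / d)
  (fun x => osc_cos l x / d) 0 s).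
rewrite Rmin_left, Rmax_right in H by lra.
rewrite osc_sin_0 in H. replace (0 / d) with 0 in H by (field; lra).
fold d in H. replace (d / d) with 1 in H by (field; lra).
fold (arc_int (l * d ^ 2)) in H.
assert (H1 := is_RInt_derive (V := R_CompleteNormedModule) (fun x => 2 * osc_vol l x / d ^ 3)
  (fun x => osc_sin l x ^ 2 / d ^ 3) 0 s).
rewrite Rmin_left, Rmax_right in H1 by lra.
assert (Hv : 2 * osc_vol l s / d ^ 3 = arc_int (l * d ^ 2)).
2:{ rewrite <- Hv; field; lra. }
assert (I1 : is_RInt (fun x => osc_sin l x ^ 2 / d ^ 3) 0 s (2 * osc_vol l s / d ^ 3)).
{ evar_last; [apply H1|].
  - intros x Hx. generalize (is_derive_osc_vol l x); intro.
    derive_using; field; lra.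
  - intros x Hx. generalize (is_derive_osc_sin l x); intro Hx'.
    apply (ex_derive_continuous (V := R_NormedModule)).
    eexists; derive_using; reflexivity.
  - rewrite osc_vol_0; unfold minus, plus, opp; simpl; field; lra. }
rewrite <- (is_RInt_unique _ _ _ _ I1). apply is_RInt_unique.
eapply is_RInt_ext; [|apply H].
- rewrite Rmin_left, Rmax_right by lra. intros x Hx. simpl.
  unfold scal; simpl; unfold mult; simpl.
  specialize (E x); simpl in E; rewrite E. specialize (Cpos x ltac:(lra)).
  replace (osc_cos l x * (osc_cos l x * 1)) with (Rsqr (osc_cos l x)) by (unfold Rsqr; ring).
  rewrite sqrt_Rsqr by lra. field; lra.
- intros x Hx. apply continuous_arc_int_fun. rewrite E. apply pow_lt; now apply Cpos.
- intros x Hx. generalize (is_derive_osc_sin l x) (is_derive_osc_cos l x); intros; split.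
  + derive_using; field; lra.
  + apply (ex_derive_continuous (V := R_NormedModule)).
    eexists; derive_using; reflexivity.
Qed.

(* For [th = l * osc_sin l sh ^ 2], with [sh] half of the fictitious time, this is [osc_sin l sh]. *)
Definition half_sin (mu nu th : R) : R := sqrt ((nu + mu * th / (1 - th)) / 2).

Definition arc_time (mu nu th : R) : R :=
  mu * half_sin mu nu th / (2 * sqrt (1 - th)) + half_sin mu nu th ^ 3 * arc_int th.

Lemma half_sin_arg_lt mu nu th1 th2 : 0 < mu -> th1 < th2 -> th2 < 1 ->
  (nu + mu * th1 / (1 - th1)) / 2 < (nu + mu * th2 / (1 - th2)) / 2.
Proof.
intros Hm H12 H2.
assert (/ (1 - th1) < / (1 - th2)) by (apply Rinv_lt_contravar; nra).
replace (mu * th1 / (1 - th1)) with (mu * (/ (1 - th1) - 1)) by (field; lra).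
replace (mu * th2 / (1 - th2)) with (mu * (/ (1 - th2) - 1)) by (field; lra).
nra.
Qed.

(** All factors are nonnegative and nondecreasing in [th]; strictness comes from [1 / sqrt (1 - th)]
    in the first term. It requires [half_sin] to be positive at [th1]: as [sqrt] is 0 on negative
    numbers, [arc_time] vanishes identically where the argument of the root is negative. *)
Lemma arc_time_lt mu nu th1 th2 : 0 < mu -> th1 < th2 -> th2 < 1 ->
  0 < half_sin mu nu th1 -> arc_time mu nu th1 < arc_time mu nu th2.
Proof.
intros Hm H12 H2 Hd. unfold arc_time.
assert (Hd' : half_sin mu nu th1 <= half_sin mu nu th2).
{ apply sqrt_le_1_alt. left; now apply half_sin_arg_lt. }
set (d1 := half_sin mu nu th1) in *; set (d2 := half_sin mu nu th2) in *.
assert (0 < sqrt (1 - th2)) by (apply sqrt_lt_R0; lra).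
assert (sqrt (1 - th2) < sqrt (1 - th1)) by (apply sqrt_lt_1; lra).
apply Rplus_lt_le_compat.
- apply Rlt_le_trans with (mu * d1 / (2 * sqrt (1 - th2))).
  + apply Rmult_lt_compat_l; [nra|]. apply Rinv_lt_contravar; nra.
  + apply Rmult_le_compat_r; [left; apply Rinv_0_lt_compat; lra|nra].
- apply Rmult_le_compat; [left; now apply pow_lt|apply arc_int_ge_0; lra| |apply arc_int_le; lra].
  apply pow_incr; lra.
Qed.

Lemma continuity_pt_arc_time mu nu th :
  th < 1 -> 0 <= (nu + mu * th / (1 - th)) / 2 -> continuity_pt (arc_time mu nu) th.
Proof.
intros H Hd.
assert (C1 : continuity_pt (half_sin mu nu) th).
{ apply (continuity_pt_comp (fun th => (nu + mu * th / (1 - th)) / 2) sqrt).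
  - apply derivable_continuous_pt, ex_derive_Reals_0.
    auto_derive; lra.
  - now apply continuity_pt_sqrt. }
apply (continuity_pt_plus (fun th => mu * half_sin mu nu th / (2 * sqrt (1 - th)))
  (fun th => half_sin mu nu th ^ 3 * arc_int th)).
- apply (continuity_pt_mult (fun th => mu * half_sin mu nu th) (fun th => / (2 * sqrt (1 - th)))).
  + apply (continuity_pt_mult (fun _ => mu)); [now apply continuity_pt_const|easy].
  + apply derivable_continuous_pt, ex_derive_Reals_0.
    assert (0 < sqrt (1 - th)) by (apply sqrt_lt_R0; lra).
    auto_derive; repeat split; [lra|fold (1 - th); lra].
- apply continuity_pt_mult; [|now apply continuity_pt_arc_int].
  apply (continuity_pt_comp (half_sin mu nu) (fun x => x ^ 3)); [easy|].
  apply derivable_continuous_pt, derivable_pt_pow.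
Qed.

(** Intermediate values; the first term blows up as [th] tends to 1. The time becomes small at the
    other end for two different reasons: if [nu < mu] (that is [k > 0]), [half_sin] reaches zero at
    a finite [th]; if [mu < nu], it stays bounded and the other factors tend to 0 as [th] tends to
    minus infinity. *)
Lemma arc_time_surj mu nu T : 0 < mu -> 0 < nu -> mu <> nu -> 0 < T ->
  exists th, th < 1 /\ 0 < (nu + mu * th / (1 - th)) / 2 /\ arc_time mu nu th = T.
Proof.
intros Hmu Hnu Hne HT.
(* A nonpositive argument makes [sqrt], hence the time, equal to 0, contrary to [0 < T]. *)
assert (Hroot : forall th, arc_time mu nu th = T -> 0 < (nu + mu * th / (1 - th)) / 2).
{ intros th E; apply Rnot_le_lt; intro Hc. unfold arc_time in E.
  replace (half_sin mu nu th) with 0 in E by (symmetry; now apply sqrt_neg_0).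
  unfold Rdiv in E; rewrite Rmult_0_r, !Rmult_0_l, pow_i, Rmult_0_l in E by lia. lra. }
set (D := sqrt (nu / 2)).
assert (HD : 0 < D) by (apply sqrt_lt_R0; lra).
assert (Hlo : exists lo, lo < 0 /\ 0 <= (nu + mu * lo / (1 - lo)) / 2 /\ arc_time mu nu lo < T).
{ destruct (Rlt_le_dec nu mu) as [Hlt|Hle].
  (* The zero of [nu + mu th / (1 - th)]. *)
  - exists (- (nu / (mu - nu))).
    assert (0 < nu / (mu - nu)) by (apply Rdiv_lt_0_compat; lra).
    assert (E : (nu + mu * (- (nu / (mu - nu))) / (1 - - (nu / (mu - nu)))) / 2 = 0)
      by (field; lra).
    split; [lra|]. split; [lra|]. unfold arc_time, half_sin. rewrite E, sqrt_0.
    unfold Rdiv; rewrite Rmult_0_r, !Rmult_0_l, pow_i, Rmult_0_l by lia. lra.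
  (* At [th = - w^2] the time is at most [K / w], because [half_sin <= D] and both
     [1 / sqrt (1 - th)] and [arc_int th] are at most [1 / w]; [w] is then taken larger than
     [K / T]. *)
  - set (K := mu * D / 2 + D ^ 3).
    assert (HD3 : 0 < D ^ 3) by (now apply pow_lt).
    assert (HK : 0 < K) by (unfold K; nra).
    assert (HKT : 0 < K / T) by (now apply Rdiv_lt_0_compat).
    set (w := K / T + 1). exists (- w ^ 2).
    assert (Hw : 1 < w) by (unfold w; lra).
    assert (Hw2 : 0 < w ^ 2) by nra.
    split; [lra|]. split.
    { replace ((nu + mu * - w ^ 2 / (1 - - w ^ 2)) / 2)
        with ((nu + (nu - mu) * w ^ 2) / (1 + w ^ 2) / 2) by (field; nra).
      apply Rdiv_le_0_compat; [|lra]. apply Rdiv_le_0_compat; nra. }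
    unfold arc_time.
    assert (Hh : 0 <= half_sin mu nu (- w ^ 2) <= D).
    { split; [apply sqrt_pos|]. apply sqrt_le_1_alt.
      assert (0 <= mu * w ^ 2 / (1 - - w ^ 2)) by (apply Rdiv_le_0_compat; nra).
      unfold Rdiv in *; lra. }
    set (h := half_sin mu nu (- w ^ 2)) in *.
    assert (Ew : sqrt (w ^ 2) = w) by (rewrite <- Rsqr_pow2; apply sqrt_Rsqr; lra).
    assert (Hi := arc_int_le_inv_sqrt (- w ^ 2) ltac:(lra)).
    assert (Hi0 := arc_int_ge_0 (- w ^ 2) ltac:(lra)).
    rewrite Ropp_involutive, Ew in Hi.
    assert (Hs : w <= sqrt (1 - - w ^ 2)) by (rewrite <- Ew at 1; apply sqrt_le_1_alt; lra).
    apply Rle_lt_trans with (K / w).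
    + replace (K / w) with (mu * D / (2 * w) + D ^ 3 * / w) by (unfold K; field; lra).
      apply Rplus_le_compat.
      * apply Rmult_le_compat; [nra|left; apply Rinv_0_lt_compat; lra|nra|].
        apply Rinv_le_contravar; lra.
      * apply Rmult_le_compat; [apply pow_le; lra|easy| |easy]. apply pow_incr; lra.
    + apply Rlt_div_l; [lra|]. unfold w. replace (T * (K / T + 1)) with (K + T) by (field; lra). lra. }
assert (Hhi : exists hi, 0 < hi < 1 /\ T < arc_time mu nu hi).
{ assert (HmD : 0 < mu * D) by nra.
  (* At [th = 1 - e^2] the first term of the time is at least [mu D / (2 e)], and this [e] makes the
     bound equal to [T + mu D / 2]. *)
  set (e := mu * D / (2 * T + mu * D)).
  assert (He : 0 < e < 1).
  { split; [apply Rdiv_lt_0_compat; lra|]. apply Rlt_div_l; lra. }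
  assert (He2 : 0 < e ^ 2 < 1) by nra.
  exists (1 - e ^ 2). split; [lra|]. unfold arc_time.
  replace (1 - (1 - e ^ 2)) with (Rsqr e) by (unfold Rsqr; ring).
  rewrite sqrt_Rsqr by lra.
  assert (Hh : D <= half_sin mu nu (1 - e ^ 2)).
  { apply sqrt_le_1_alt.
    assert (0 <= mu * (1 - e ^ 2) / (1 - (1 - e ^ 2))) by (apply Rdiv_le_0_compat; [apply Rmult_le_pos; lra|lra]). lra. }
  set (h := half_sin mu nu (1 - e ^ 2)) in *.
  assert (Hi0 := arc_int_ge_0 (1 - e ^ 2) ltac:(lra)).
  assert (0 <= h ^ 3) by (apply pow_le; lra).
  apply Rlt_le_trans with (mu * D / (2 * e)).
  - unfold e. replace (mu * D / (2 * (mu * D / (2 * T + mu * D)))) with (T + mu * D / 2) by (field; lra).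
    lra.
  - assert (mu * D / (2 * e) <= mu * h / (2 * e)).
    { apply Rmult_le_compat_r; [left; apply Rinv_0_lt_compat; lra|nra]. }
    nra. }
destruct Hlo as (lo & Hlo0 & Hlod & Hlo), Hhi as (hi & Hhi0 & Hhi).
destruct (Ranalysis5.IVT_interv (fun th => arc_time mu nu th - T) lo hi) as (th & Hth & E); try lra.
- intros th Hth. apply continuity_pt_minus; [|now apply continuity_pt_const].
  apply continuity_pt_arc_time; [lra|].
  destruct (Req_dec lo th) as [->|Hn]; [easy|].
  left; apply Rle_lt_trans with (1 := Hlod). apply half_sin_arg_lt; lra.
- exists th. split; [lra|]. split; [apply Hroot|]; lra.
Qed.

(** * Linear flows in fictitious time *)

Lemma constant_of_derive_0 (f : R -> R) (a b : R) :
  (forall x, Rmin a b < x < Rmax a b -> is_derive f x 0) ->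
  (forall x, Rmin a b <= x <= Rmax a b -> continuity_pt f x) -> f b = f a.
Proof.
intros H1 H2. destruct (MVT_gen f a b (fun _ => 0) H1 H2) as (c & _ & E). lra.
Qed.

(** [P] holds near every point of [a, b], except perhaps at the point itself: the form in which the
    equations of motion survive isolated collisions. *)
Definition punctured (a b : R) (P : R -> Prop) : Prop :=
  forall t, a <= t <= b -> exists eps, 0 < eps /\
    forall u, a <= u <= b -> 0 < Rabs (u - t) < eps -> P u.

Lemma punctured_weaken a b (P Q : R -> Prop) :
  (forall u, a <= u <= b -> P u -> Q u) -> punctured a b P -> punctured a b Q.
Proof.
intros H HP t Ht; destruct (HP t Ht) as (e & He & Hu); exists e; split; [easy|].
intros u Hu1 Hu2; now apply H, Hu.
Qed.

(** The mean value theorem only uses derivatives strictly between [t] and [u], so a continuous [f]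
    is constant near each [t] even without a derivative at [t]; a supremum argument spreads this
    over the interval. *)
Lemma constant_of_derive_0_off_isolated (f : R -> R) (a b : R) :
  a <= b ->
  (forall t, a <= t <= b -> continuity_pt f t) ->
  punctured a b (fun u => is_derive f u 0) ->
  forall t, a <= t <= b -> f t = f a.
Proof.
intros Hab Hc Hp.
assert (Hloc : forall t, a <= t <= b -> exists eps, 0 < eps /\
   forall u, a <= u <= b -> Rabs (u - t) < eps -> f u = f t).
{ intros t Ht. destruct (Hp t Ht) as (e & He & Hd). exists e; split; [easy|].
  intros u Hu Hut. apply constant_of_derive_0.
  - intros x Hx. unfold Rmin, Rmax in Hx. apply Rabs_def2 in Hut.
    destruct (Rle_dec t u); (apply Hd; [lra|]);
      (split; [apply Rabs_pos_lt; lra|apply Rabs_def1; lra]).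
  - intros x Hx; apply Hc. unfold Rmin, Rmax in Hx. destruct (Rle_dec t u); lra. }
set (E := fun x => a <= x <= b /\ forall t, a <= t <= x -> f t = f a).
assert (Ea : E a).
{ split; [lra|]. intros t Ht; f_equal; lra. }
destruct (completeness E) as (m & Hub & Hlub).
{ exists b; intros x Hx; apply Hx. }
{ now exists a. }
assert (Hm : a <= m <= b).
{ split; [now apply Hub|]. apply Hlub; intros x Hx; apply Hx. }
destruct (Hloc m Hm) as (e & He & Hf).
assert (Hx : exists x, E x /\ m - e < x).
{ apply Classical_Prop.NNPP; intro Hn. assert (m <= m - e); [|lra].
  apply Hlub. intros x Ex. apply Rnot_lt_le; intro. apply Hn; now exists x. }
destruct Hx as (x & Ex & Hx). assert (Hxm : x <= m) by now apply Hub.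
assert (Hfm : f m = f a).
{ rewrite <- (Hf x); [|apply Ex|apply Rabs_def1; lra]. apply Ex; split; [apply Ex|lra]. }
assert (Hall : forall t, a <= t <= b -> t < m + e -> f t = f a).
{ intros t Ht Htm. destruct (Rle_dec t x) as [H|H]; [apply Ex; lra|].
  rewrite <- Hfm. apply Hf; [easy|]. apply Rabs_def1; lra. }
assert (Hmb : m = b).
{ apply Rle_antisym; [lra|]. apply Rnot_lt_le; intro Hlt.
  assert (Ey : E (Rmin b (m + e / 2))).
  { assert (Rmin b (m + e / 2) <= b) by apply Rmin_l.
    assert (Rmin b (m + e / 2) <= m + e / 2) by apply Rmin_r.
    assert (m < Rmin b (m + e / 2)) by (apply Rmin_glb_lt; lra).
    split; [lra|]. intros t Ht; apply Hall; lra. }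
  assert (Rmin b (m + e / 2) <= m) by now apply Hub.
  assert (m < Rmin b (m + e / 2)) by (apply Rmin_glb_lt; lra). lra. }
intros t Ht; apply Hall; lra.
Qed.

(* In fictitious time both the position and its norm are of the form [flow0],
   with successive derivatives [flow1] and [flow2]. *)
Definition flow0 (l x0 x1 x2 s : R) : R :=
  x0 + x1 * (osc_cos l s * osc_sin l s) + x2 * (osc_sin l s ^ 2 / 2).

Definition flow1 (l x1 x2 s : R) : R :=
  x1 * (osc_cos l s ^ 2 - l * osc_sin l s ^ 2) + x2 * (osc_cos l s * osc_sin l s).

Definition flow2 (l x1 x2 s : R) : R :=
  x2 * (osc_cos l s ^ 2 - l * osc_sin l s ^ 2) - 4 * l * x1 * (osc_cos l s * osc_sin l s).

Lemma is_derive_flow0 l x0 x1 x2 s :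
  is_derive (flow0 l x0 x1 x2) s (flow1 l x1 x2 s).
Proof.
unfold flow0, flow1.
generalize (is_derive_osc_sin l s) (is_derive_osc_cos l s); intros.
derive_using. field.
Qed.

Lemma is_derive_flow1 l x1 x2 s :
  is_derive (flow1 l x1 x2) s (flow2 l x1 x2 s).
Proof.
unfold flow1, flow2.
generalize (is_derive_osc_sin l s) (is_derive_osc_cos l s); intros.
derive_using. ring.
Qed.

Definition flow_time (l r0 p0 s : R) : R :=
  r0 * s + p0 * (osc_sin l s ^ 2 / 2) + (1 - 4 * l * r0) * osc_vol l s.

Lemma is_derive_flow_time l r0 p0 s :
  is_derive (flow_time l r0 p0) s (flow0 l r0 p0 (1 - 4 * l * r0) s).
Proof.
unfold flow_time, flow0.
generalize (is_derive_osc_sin l s) (is_derive_osc_vol l s); intros.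
derive_using. field.
Qed.

Lemma is_derive_continuity_pt (f : R -> R) (x y : R) : is_derive f x y -> continuity_pt f x.
Proof. intros H; apply derivable_continuous_pt, ex_derive_Reals_0; now exists y. Qed.

Lemma continuity_pt_osc_sin l s : continuity_pt (osc_sin l) s.
Proof. apply (is_derive_continuity_pt _ _ _ (is_derive_osc_sin l s)). Qed.
Lemma continuity_pt_osc_cos l s : continuity_pt (osc_cos l) s.
Proof. apply (is_derive_continuity_pt _ _ _ (is_derive_osc_cos l s)). Qed.

Lemma is_derive_comp_R (f g : R -> R) x df dg :
  is_derive f (g x) df -> is_derive g x dg -> is_derive (fun x => f (g x)) x (df * dg).
Proof.
intros H1 H2; evar_last; [now apply is_derive_comp with (1 := H1) (2 := H2)|].
unfold scal; simpl; unfold mult; simpl; ring.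
Qed.

Ltac cont :=
  repeat first
  [ assumption
  | apply continuity_pt_const; easy
  | match goal with
    | |- continuity_pt (fun t => @?f t - @?g t) _ => apply (continuity_pt_minus f g)
    | |- continuity_pt (fun t => @?f t + @?g t) _ => apply (continuity_pt_plus f g)
    | |- continuity_pt (fun t => @?f t * @?g t) _ => apply (continuity_pt_mult f g)
    end ].

Section FlowUniqueness.
Variables (l T : R) (rho s x y z : R -> R).
Hypothesis T_pos : 0 < T.
Hypothesis s0 : s 0 = 0.
Hypothesis Cs : forall t, 0 <= t <= T -> continuity_pt s t.
Hypothesis Cx : forall t, 0 <= t <= T -> continuity_pt x t.
Hypothesis Cy : forall t, 0 <= t <= T -> continuity_pt y t.
Hypothesis Cz : forall t, 0 <= t <= T -> continuity_pt z t.
Hypothesis Ds : punctured 0 T (fun t => rho t <> 0 /\ is_derive s t (/ rho t) /\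
  is_derive x t (y t / rho t) /\ is_derive y t (z t / rho t) /\
  is_derive z t (- 4 * l * y t / rho t)).

(** In fictitious time the hypotheses read [x' = y], [y' = z], [z' = - 4 l y], off isolated
    instants. Moving [(y, z)] back by the inverse linear flow gives quantities of zero derivative,
    which continuity keeps constant through the exceptional instants; [x] follows by integration. *)
Lemma flow_unique t : 0 <= t <= T -> x t = flow0 l (x 0) (y 0) (z 0) (s t).
Proof.
set (c := fun t => osc_cos l (s t)). set (v := fun t => osc_sin l (s t)).
assert (Cc : forall t, 0 <= t <= T -> continuity_pt c t).
{ intros u Hu; apply (continuity_pt_comp s (osc_cos l)); [now apply Cs|apply continuity_pt_osc_cos]. }
assert (Cv : forall t, 0 <= t <= T -> continuity_pt v t).
{ intros u Hu; apply (continuity_pt_comp s (osc_sin l)); [now apply Cs|apply continuity_pt_osc_sin]. }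
assert (Dc : forall t, is_derive s t (/ rho t) -> is_derive c t (- l * v t * / rho t)).
{ intros u Hu; apply (is_derive_comp_R (osc_cos l) s); [apply is_derive_osc_cos|easy]. }
assert (Dv : forall t, is_derive s t (/ rho t) -> is_derive v t (c t * / rho t)).
{ intros u Hu; apply (is_derive_comp_R (osc_sin l) s); [apply is_derive_osc_sin|easy]. }
assert (E : forall t, c t * c t = 1 - l * (v t * v t)).
{ intros u; unfold c, v; generalize (osc_pythagoras l (s u)); lra. }
assert (c0 : c 0 = 1) by (unfold c; now rewrite s0, osc_cos_0).
assert (v0 : v 0 = 0) by (unfold v; now rewrite s0, osc_sin_0).
assert (H1 : forall t, 0 <= t <= T ->
  y t * (c t * c t - l * (v t * v t)) - z t * (c t * v t) = y 0).
{ intros u Hu.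
  rewrite (constant_of_derive_0_off_isolated
    (fun t => y t * (c t * c t - l * (v t * v t)) - z t * (c t * v t)) 0 T); try easy; try lra.
  - rewrite c0, v0; ring.
  - intros w Hw. specialize (Cc w Hw); specialize (Cv w Hw); specialize (Cy w Hw); specialize (Cz w Hw).
    cont.
  - refine (punctured_weaken _ _ _ _ _ Ds).
    intros w Hw (Hr & D1 & D2 & D3 & D4).
    specialize (Dc w D1); specialize (Dv w D1).
    derive_using. field; easy. }
assert (H2 : forall t, 0 <= t <= T ->
  z t * (c t * c t - l * (v t * v t)) + 4 * l * (y t * (c t * v t)) = z 0).
{ intros u Hu.
  rewrite (constant_of_derive_0_off_isolated
    (fun t => z t * (c t * c t - l * (v t * v t)) + 4 * l * (y t * (c t * v t))) 0 T); try easy; try lra.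
  - rewrite c0, v0; ring.
  - intros w Hw. specialize (Cc w Hw); specialize (Cv w Hw); specialize (Cy w Hw); specialize (Cz w Hw).
    cont.
  - refine (punctured_weaken _ _ _ _ _ Ds).
    intros w Hw (Hr & D1 & D2 & D3 & D4).
    specialize (Dc w D1); specialize (Dv w D1).
    derive_using. field; easy. }
(* The two conservation laws are solved for [y]; the determinant of this linear system is
   [(c^2 + l v^2)^2 = 1]. *)
assert (Hy : forall t, 0 <= t <= T ->
  y t = y 0 * (c t * c t - l * (v t * v t)) + z 0 * (c t * v t)).
{ intros u Hu. rewrite <- (H1 u Hu), <- (H2 u Hu).
  transitivity (y u * ((c u * c u + l * (v u * v u)) ^ 2)); [|ring].
  rewrite E; ring. }
intros Ht.
assert (H3 : x t - y 0 * (c t * v t) - z 0 * (/ 2 * (v t * v t)) = x 0).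
{ rewrite (constant_of_derive_0_off_isolated
    (fun t => x t - y 0 * (c t * v t) - z 0 * (/ 2 * (v t * v t))) 0 T); try easy; try lra.
  - rewrite c0, v0; ring.
  - intros w Hw. specialize (Cc w Hw); specialize (Cv w Hw); specialize (Cx w Hw). cont.
  - refine (punctured_weaken _ _ _ _ _ Ds).
    intros w Hw (Hr & D1 & D2 & D3 & D4).
    specialize (Dc w D1); specialize (Dv w D1). rewrite (Hy w Hw) in D2.
    derive_using. field; easy. }
unfold flow0. fold (c t) (v t). rewrite <- H3. field.
Qed.
End FlowUniqueness.

(** Off the collisions [flow_time] composed with [s] has derivative [rho * / rho = 1]. *)
Lemma flow_time_unique (l T : R) (rho s p : R -> R) :
  0 < T -> s 0 = 0 ->
  (forall t, 0 <= t <= T -> continuity_pt s t) ->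
  punctured 0 T (fun t => rho t <> 0 /\ is_derive s t (/ rho t)) ->
  (forall t, 0 <= t <= T -> rho t = flow0 l (rho 0) (p 0) (1 - 4 * l * rho 0) (s t)) ->
  forall t, 0 <= t <= T -> flow_time l (rho 0) (p 0) (s t) = t.
Proof.
intros HT s0 Cs Ds Hr t Ht.
enough (flow_time l (rho 0) (p 0) (s t) - t = flow_time l (rho 0) (p 0) (s 0) - 0) as H.
{ rewrite s0 in H. unfold flow_time in H at 2.
  rewrite osc_sin_0, osc_vol_0 in H. lra. }
apply (constant_of_derive_0_off_isolated
  (fun t => flow_time l (rho 0) (p 0) (s t) - t) 0 T); try easy; try lra.
- intros w Hw. apply (continuity_pt_minus (fun t => flow_time l (rho 0) (p 0) (s t)) (fun t => t)).
  + apply (continuity_pt_comp s (flow_time l (rho 0) (p 0))); [now apply Cs|].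
    apply (is_derive_continuity_pt _ _ _ (is_derive_flow_time l (rho 0) (p 0) (s w))).
  + apply derivable_continuous_pt, derivable_pt_id.
- refine (punctured_weaken _ _ _ _ _ Ds). intros w Hw (Hn & D).
  assert (D' := is_derive_comp_R _ _ _ _ _ (is_derive_flow_time l (rho 0) (p 0) (s w)) D).
  rewrite <- Hr in D' by easy.
  set (f := fun t => flow_time l (rho 0) (p 0) (s t)) in *.
  change (is_derive (fun t => f t - t) w 0).
  derive_using. field; easy.
Qed.

(** * Keplerian arcs in fictitious time *)

Definition dot (d : nat) (x y : Vec) : R := vsum d (fun i => x i * y i).

Lemma vsum_ext n f g : (forall i, (i < n)%nat -> f i = g i) -> vsum n f = vsum n g.
Proof.
induction n as [|n IH]; intros H; simpl; [easy|].
rewrite IH, (H n) by (intros; try apply H; lia); easy.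
Qed.

Lemma vsum_lin n a b f g :
  vsum n (fun i => a * f i + b * g i) = a * vsum n f + b * vsum n g.
Proof. induction n as [|n IH]; simpl; [ring|rewrite IH; ring]. Qed.

Lemma vsum_nonneg n f : (forall i, (i < n)%nat -> 0 <= f i) -> 0 <= vsum n f.
Proof.
induction n as [|n IH]; intros H; simpl; [lra|].
assert (0 <= f n) by (apply H; lia).
assert (0 <= vsum n f) by (apply IH; intros; apply H; lia). lra.
Qed.

Lemma vsum_nonneg_0 n f : (forall i, (i < n)%nat -> 0 <= f i) -> vsum n f = 0 ->
  forall i, (i < n)%nat -> f i = 0.
Proof.
induction n as [|n IH]; intros H E i Hi; simpl in *; [lia|].
assert (0 <= f n) by (apply H; lia).
assert (0 <= vsum n f) by (apply vsum_nonneg; intros; apply H; lia).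
destruct (Nat.eq_dec i n) as [->|Hn]; [lra|].
apply IH; [intros; apply H; lia|lra|lia].
Qed.

Lemma is_derive_vsum n (f df : nat -> R -> R) (t : R) :
  (forall i, (i < n)%nat -> is_derive (f i) t (df i t)) ->
  is_derive (fun t => vsum n (fun i => f i t)) t (vsum n (fun i => df i t)).
Proof.
induction n as [|n IH]; intros H; simpl.
- apply is_derive_Reals, derivable_pt_lim_const.
- apply (is_derive_plus (fun t => vsum n (fun i => f i t)) (f n)); [apply IH|apply H]; auto with arith.
Qed.

Lemma dot_ext d x y x' y' : (forall i, (i < d)%nat -> x i = x' i) ->
  (forall i, (i < d)%nat -> y i = y' i) -> dot d x y = dot d x' y'.
Proof. intros H1 H2; apply vsum_ext; intros; rewrite H1, H2; easy. Qed.

Lemma dot_comm d x y : dot d x y = dot d y x.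
Proof. apply vsum_ext; intros; ring. Qed.

Lemma dot_lin d a b x y z :
  dot d (fun i => a * x i + b * y i) z = a * dot d x z + b * dot d y z.
Proof. unfold dot; rewrite <- vsum_lin; apply vsum_ext; intros; ring. Qed.

Lemma dot_lin_self d a b x y :
  dot d (fun i => a * x i + b * y i) (fun i => a * x i + b * y i) =
  a ^ 2 * dot d x x + 2 * a * b * dot d x y + b ^ 2 * dot d y y.
Proof.
rewrite dot_lin, !(dot_comm d _ (fun i => a * x i + b * y i)), !dot_lin.
rewrite (dot_comm d y x); ring.
Qed.

Lemma dot_self_nonneg d x : 0 <= dot d x x.
Proof. apply vsum_nonneg; intros; nra. Qed.

Lemma dot_self_0 d x : dot d x x = 0 -> forall i, (i < d)%nat -> x i = 0.
Proof.
intros H i Hi. assert (x i * x i = 0); [|nra].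
apply (vsum_nonneg_0 d (fun i => x i * x i)); auto; intros; nra.
Qed.

Lemma vnorm_dot d x : vnorm d x = sqrt (dot d x x).
Proof. unfold vnorm, dot; f_equal; apply vsum_ext; intros; ring. Qed.

Lemma vnorm_sqr d x : vnorm d x ^ 2 = dot d x x.
Proof. rewrite vnorm_dot, pow2_sqrt; [easy|apply dot_self_nonneg]. Qed.

Lemma vnorm_nonneg d x : 0 <= vnorm d x.
Proof. apply sqrt_pos. Qed.

Lemma vnorm_unique d x r : 0 <= r -> dot d x x = r ^ 2 -> vnorm d x = r.
Proof.
intros Hr E; rewrite vnorm_dot, E.
rewrite <- Rsqr_pow2; now apply sqrt_Rsqr.
Qed.

Lemma vnorm_pos d x : InSpace d x -> ~ veq x (fun _ => 0) -> 0 < vnorm d x.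
Proof.
intros Hs Hn; apply Rnot_le_lt; intro H. apply Hn; intro i.
destruct (Nat.lt_ge_cases i d) as [Hi|Hi]; [|now apply Hs].
apply (dot_self_0 d); [|easy]. rewrite <- vnorm_sqr.
generalize (vnorm_nonneg d x); intro. assert (E : vnorm d x = 0) by lra. rewrite E; ring.
Qed.

Lemma cauchy_schwarz d x y : dot d x y ^ 2 <= dot d x x * dot d y y.
Proof.
destruct (Rle_lt_or_eq_dec _ _ (dot_self_nonneg d x)) as [H|H].
- generalize (dot_self_nonneg d (fun i => (- dot d x y) * x i + dot d x x * y i)).
  rewrite dot_lin_self. intro. nra.
- assert (E := dot_self_0 d x (eq_sym H)). rewrite <- H.
  rewrite (dot_ext d x y (fun _ => 0) y); [|easy|easy].
  assert (E0 : dot d (fun _ => 0) y = 0).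
  { unfold dot; rewrite (vsum_ext d _ (fun i => 0 * y i + 0 * y i)) by (intros; ring).
    rewrite vsum_lin; ring. }
  rewrite E0; lra.
Qed.

(* [orb_par] is [- h / 2], where [h] is the energy of the motion starting from [A] with velocity [v]. *)
Definition orb_par d (A v : Vec) : R := (/ vnorm d A - dot d v v / 2) / 2.
(** The coefficients are the initial first and second derivatives in fictitious time: [q' = |q| v]
    and [q'' = (q.v) v - q / |q|]. For [|q|] in [orb_rad] they are [q.v] and [1 - 4 l |q|]. *)
Definition orb_pos d (A v : Vec) (s : R) : Vec := fun i =>
  flow0 (orb_par d A v) (A i) (vnorm d A * v i) (dot d A v * v i - A i / vnorm d A) s.
Definition orb_rad d (A v : Vec) (s : R) : R :=
  flow0 (orb_par d A v) (vnorm d A) (dot d A v) (1 - 4 * orb_par d A v * vnorm d A) s.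
Definition orb_time d (A v : Vec) (s : R) : R :=
  flow_time (orb_par d A v) (vnorm d A) (dot d A v) s.

(** Common normal form of regular and rectilinear arcs, valid across collisions; [s] is the
    fictitious time as a function of [t]. *)
Definition follows_orbit d (A v : Vec) (T : R) (q : R -> Vec) (s : R -> R) : Prop :=
  forall t, 0 <= t <= T ->
    (forall i, (i < d)%nat -> q t i = orb_pos d A v (s t) i) /\ orb_time d A v (s t) = t.

(** Conservation of energy gives [|v|^2 = 2 / r - 4 l]. With it, both [(q, r v, p v - q / r)],
    coordinate by coordinate, and [(r, p, 1 - 4 l r)], where [p = q.v], satisfy the linear system of
    [flow_unique]. *)
Lemma regular_follows_orbit d T q : 0 < T -> KeplerRegular d 0 T q ->
  exists v s, follows_orbit d (q 0) v T q s.
Proof.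
intros HT [v Hv].
assert (Hr : forall t, 0 <= t <= T -> 0 < vnorm d (q t)).
{ intros t Ht. destruct (Hv t Ht) as (_ & Hn & _). generalize (vnorm_nonneg d (q t)); lra. }
assert (Dq : forall t i, 0 <= t <= T -> (i < d)%nat -> is_derive (fun u => q u i) t (v t i)).
{ intros t i Ht Hi; apply is_derive_Reals. now apply (Hv t Ht). }
assert (Dv : forall t i, 0 <= t <= T -> (i < d)%nat ->
  is_derive (fun u => v u i) t (- q t i / vnorm d (q t) ^ 3)).
{ intros t i Ht Hi; apply is_derive_Reals. now apply (Hv t Ht). }
set (r := fun t => vnorm d (q t)) in *. set (p := fun t => dot d (q t) (v t)).
set (k := fun t => dot d (v t) (v t)).
assert (Dr : forall t, 0 <= t <= T -> is_derive r t (p t / r t)).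
{ intros t Ht.
  assert (D : is_derive (fun t => dot d (q t) (q t)) t (2 * p t)).
  { evar_last; [apply (is_derive_vsum d (fun i t => q t i * q t i) (fun i t => 2 * q t i * v t i))|].
    - intros i Hi. specialize (Dq t i Ht Hi).
      pose (qi := fun u : R => q u i). change (is_derive qi t (v t i)) in Dq.
      change (is_derive (fun t => qi t * qi t) t (2 * qi t * v t i)). derive_using. ring.
    - unfold p, dot. rewrite <- (Rplus_0_r (2 * _)), <- (Rmult_0_l (vsum d (fun _ => 0))), <- vsum_lin.
      apply vsum_ext; intros; ring. }
  apply (is_derive_ext (fun t => sqrt (dot d (q t) (q t)))).
  { intros u; unfold r; now rewrite vnorm_dot. }
  assert (0 < dot d (q t) (q t)).
  { rewrite <- vnorm_sqr; apply pow_lt; now apply Hr. }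
  set (f := fun t => dot d (q t) (q t)) in *. change (is_derive (fun t => sqrt (f t)) t (p t / r t)).
  derive_using; [easy|]. change (r t) with (vnorm d (q t)); rewrite vnorm_dot; fold (f t). field.
  apply Rgt_not_eq, sqrt_lt_R0; easy. }
assert (Eq : forall t, dot d (q t) (q t) = r t ^ 2) by (intros; unfold r; now rewrite vnorm_sqr).
assert (Dp : forall t, 0 <= t <= T -> is_derive p t (k t - / r t)).
{ intros t Ht. specialize (Hr t Ht); fold (r t) in Hr.
  evar_last; [apply (is_derive_vsum d (fun i t => q t i * v t i)
    (fun i t => v t i * v t i + q t i * (- q t i / r t ^ 3)))|].
  - intros i Hi. specialize (Dq t i Ht Hi); specialize (Dv t i Ht Hi).
    pose (qi := fun u : R => q u i). pose (vi := fun u : R => v u i).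
    change (is_derive qi t (vi t)) in Dq. change (is_derive vi t (- qi t / r t ^ 3)) in Dv.
    change (is_derive (fun t => qi t * vi t) t (vi t * vi t + qi t * (- qi t / r t ^ 3))).
    derive_using. ring.
  - rewrite (vsum_ext d _ (fun i => 1 * (v t i * v t i) + (- / r t ^ 3) * (q t i * q t i)))
      by (intros; field; lra).
    rewrite vsum_lin. fold (dot d (v t) (v t)) (dot d (q t) (q t)).
    rewrite Eq; unfold k; field; lra. }
assert (Dk : forall t, 0 <= t <= T -> is_derive k t (- 2 * p t / r t ^ 3)).
{ intros t Ht. specialize (Hr t Ht); fold (r t) in Hr.
  evar_last; [apply (is_derive_vsum d (fun i t => v t i * v t i)
    (fun i t => 2 * v t i * (- q t i / r t ^ 3)))|].
  - intros i Hi. specialize (Dv t i Ht Hi).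
    pose (vi := fun u : R => v u i). change (is_derive vi t (- q t i / r t ^ 3)) in Dv.
    change (is_derive (fun t => vi t * vi t) t (2 * vi t * (- q t i / r t ^ 3))).
    derive_using. ring.
  - rewrite (vsum_ext d _ (fun i => (- 2 / r t ^ 3) * (q t i * v t i) + 0 * (q t i * v t i)))
      by (intros; field; lra).
    rewrite vsum_lin. unfold p, dot; field; lra. }
set (l := orb_par d (q 0) (v 0)).
assert (Ek : forall t, 0 <= t <= T -> k t = 2 / r t - 4 * l).
{ intros t Ht.
  enough (k t - 2 * / r t = k 0 - 2 * / r 0) as E.
  { unfold l, orb_par. fold (r 0) (k 0). lra. }
  apply (constant_of_derive_0 (fun t => k t - 2 * / r t));
    rewrite Rmin_left, Rmax_right by lra; intros x Hx.
  - specialize (Hr x ltac:(lra)); fold (r x) in Hr.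
    specialize (Dr x ltac:(lra)); specialize (Dk x ltac:(lra)). derive_using. field; lra.
  - specialize (Hr x ltac:(lra)); fold (r x) in Hr.
    specialize (Dr x ltac:(lra)); specialize (Dk x ltac:(lra)).
    apply derivable_continuous_pt, ex_derive_Reals_0. eexists; derive_using; reflexivity. }
set (s := fun t => p t - p 0 + 4 * l * t).
assert (Dp' : forall t, 0 <= t <= T -> is_derive p t ((1 - 4 * l * r t) / r t)).
{ intros t Ht. specialize (Hr t Ht); fold (r t) in Hr.
  evar_last; [now apply Dp|]. rewrite Ek by easy; field; lra. }
assert (Dst : forall t, 0 <= t <= T -> is_derive s t (/ r t)).
{ intros t Ht. specialize (Dp' t Ht). specialize (Hr t Ht); fold (r t) in Hr.
  unfold s. derive_using. field; lra. }
assert (s0 : s 0 = 0) by (unfold s; ring).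
assert (Hall : forall P : R -> Prop, (forall t, 0 <= t <= T -> P t) -> punctured 0 T P).
{ intros P HP t Ht; exists 1; split; [lra|]. intros; now apply HP. }
assert (Hcont : forall f df : R -> R, (forall t, 0 <= t <= T -> is_derive f t (df t)) ->
  forall t, 0 <= t <= T -> continuity_pt f t).
{ intros f df D t Ht; apply (is_derive_continuity_pt _ _ _ (D t Ht)). }
assert (Dz : forall t, 0 <= t <= T -> is_derive (fun t => 1 - 4 * l * r t) t (- 4 * l * p t / r t)).
{ intros t Ht. specialize (Dr t Ht). specialize (Hr t Ht); fold (r t) in Hr.
  derive_using. field; lra. }
exists (v 0), s. intros t Ht. split.
- intros i Hi.
  pose (qi := fun u : R => q u i). pose (vi := fun u : R => v u i).
  assert (Dqi : forall t, 0 <= t <= T -> is_derive qi t (vi t)) by (intros; now apply Dq).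
  assert (Dvi : forall t, 0 <= t <= T -> is_derive vi t (- qi t / r t ^ 3)) by (intros; now apply Dv).
  change (qi t = flow0 l (qi 0) (r 0 * vi 0) (p 0 * vi 0 - qi 0 / r 0) (s t)).
  assert (D1 : forall t, 0 <= t <= T -> is_derive qi t (r t * vi t / r t)).
  { intros u Hu. specialize (Hr u Hu); fold (r u) in Hr.
    evar_last; [now apply Dqi|]. field; lra. }
  assert (D2 : forall t, 0 <= t <= T ->
     is_derive (fun t => r t * vi t) t ((p t * vi t - qi t / r t) / r t)).
  { intros u Hu. specialize (Dr u Hu); specialize (Dvi u Hu).
    specialize (Hr u Hu); fold (r u) in Hr. derive_using. field; lra. }
  assert (D3 : forall t, 0 <= t <= T ->
     is_derive (fun t => p t * vi t - qi t / r t) t (- 4 * l * (r t * vi t) / r t)).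
  { intros u Hu. specialize (Dr u Hu); specialize (Dvi u Hu).
    specialize (Dp' u Hu); specialize (Dqi u Hu).
    specialize (Hr u Hu); fold (r u) in Hr. derive_using. field; lra. }
  apply (flow_unique l T r s qi (fun t => r t * vi t)
    (fun t => p t * vi t - qi t / r t)); try easy.
  + now apply (Hcont _ _ Dst).
  + now apply (Hcont _ _ D1).
  + now apply (Hcont _ _ D2).
  + now apply (Hcont _ _ D3).
  + apply Hall; intros u Hu. split; [apply Rgt_not_eq, Hr, Hu|]. auto.
- apply (flow_time_unique l T r s p); try easy.
  + now apply (Hcont _ _ Dst).
  + apply Hall; intros u Hu. split; [apply Rgt_not_eq, Hr, Hu|]. auto.
  + intros u Hu. apply (flow_unique l T r s r p (fun t => 1 - 4 * l * r t)); try easy.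
    * now apply (Hcont _ _ Dst).
    * now apply (Hcont _ _ Dr).
    * now apply (Hcont _ _ Dp').
    * now apply (Hcont _ _ Dz).
    * apply Hall; intros w Hw. split; [apply Rgt_not_eq, Hr, Hw|]. auto.
Qed.

Lemma continuity_pt_pos_near (f : R -> R) (t : R) : continuity_pt f t -> 0 < f t ->
  exists eps, 0 < eps /\ forall u, Rabs (u - t) < eps -> 0 < f u.
Proof.
intros H Hp. destruct (H (f t) Hp) as (e & He & Hu). exists e; split; [easy|].
intros u Hut. destruct (Req_dec u t) as [->|Hn]; [easy|].
specialize (Hu u). simpl in Hu. unfold D_x, no_cond, R_dist in Hu.
assert (Rabs (f u - f t) < f t) by (apply Hu; repeat split; auto).
apply Rabs_def2 in H0; lra.
Qed.

(** [rd] is unconstrained at a collision, so the argument runs on [p = r rd], which is continuous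
    there with value 0. The arc does not start at [O], so [rd 0 * u] is a genuine initial
    velocity. *)
Lemma rectilinear_follows_orbit d T q :
  0 < T -> 0 < vnorm d (q 0) -> 0 < vnorm d (q T) -> KeplerRectilinear d 0 T q ->
  exists v s, follows_orbit d (q 0) v T q s.
Proof.
intros HT H0 H1 (u & r & rd & h & _ & Hu & H).
assert (Hu2 : dot d u u = 1) by (rewrite <- vnorm_sqr, Hu; ring).
assert (Hq : forall t i, 0 <= t <= T -> q t i = r t * u i) by (intros; now apply H).
assert (Hr0 : forall t, 0 <= t <= T -> 0 <= r t) by (intros; now apply H).
assert (Hn : forall t, 0 <= t <= T -> vnorm d (q t) = r t).
{ intros t Ht; apply vnorm_unique; [now apply Hr0|].
  rewrite (dot_ext d _ _ (fun i => r t * u i + 0 * u i) (fun i => r t * u i + 0 * u i))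
    by (intros; rewrite Hq by easy; ring).
  rewrite dot_lin_self, Hu2; ring. }
rewrite Hn in H0, H1 by lra.
assert (Cr : forall t, 0 <= t <= T -> continuity_pt r t) by (intros; now apply H).
assert (Dr : forall t, 0 <= t <= T -> 0 < r t -> is_derive r t (rd t)).
{ intros t Ht Hp; apply is_derive_Reals. now apply (H t Ht). }
assert (Drd : forall t, 0 <= t <= T -> 0 < r t -> is_derive rd t (- 1 / r t ^ 2)).
{ intros t Ht Hp; apply is_derive_Reals. now apply (H t Ht). }
assert (He : forall t, 0 <= t <= T -> 0 < r t -> rd t ^ 2 = 2 * h + 2 / r t).
{ intros t Ht Hp. assert (rd t ^ 2 / 2 - 1 / r t = h) by now apply (H t Ht).
  unfold Rdiv in *; lra. }
assert (Hgood : punctured 0 T (fun t => 0 < r t)).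
{ intros t Ht. destruct (Rle_lt_or_eq_dec _ _ (Hr0 t Ht)) as [Hp|Hz].
  - destruct (continuity_pt_pos_near r t (Cr t Ht) Hp) as (e & He0 & Hw).
    exists e; split; [easy|]. intros w _ Hwt; apply Hw; lra.
  - destruct (H t Ht) as (_ & _ & _ & _ & Hi). destruct (Hi (eq_sym Hz)) as (e & He0 & Hw).
    exists e; split; [easy|]. intros w Hw1 Hw2. specialize (Hw w Hw1 Hw2).
    specialize (Hr0 w Hw1); lra. }
set (p := fun t => r t * rd t).
set (l := - h / 2).
assert (Dp : forall t, 0 <= t <= T -> 0 < r t -> is_derive p t ((1 - 4 * l * r t) / r t)).
{ intros t Ht Hp. specialize (Dr t Ht Hp); specialize (Drd t Ht Hp).
  unfold p; derive_using. transitivity (rd t ^ 2 - / r t); [field; lra|].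
  rewrite He by easy. unfold l; field; lra. }
(* At a collision [p] vanishes, and the energy relation [p^2 = 2 r + 2 h r^2] makes it continuous. *)
assert (Cp : forall t, 0 <= t <= T -> continuity_pt p t).
{ intros t Ht. destruct (Rle_lt_or_eq_dec _ _ (Hr0 t Ht)) as [Hp|Hz].
  - apply (is_derive_continuity_pt _ _ _ (Dp t Ht Hp)).
  (* The ends are not collisions, so a full neighbourhood of [t] lies in [0, T], where the energy
     relation is available. *)
  - assert (Ht' : 0 < t < T).
    { split; apply Rnot_le_lt; intro Hc; [replace t with 0 in Hz by lra|replace t with T in Hz by lra]; lra. }
    assert (Cw : continuity_pt (fun t => 2 * r t + 2 * Rabs h * (r t * r t)) t).
    { specialize (Cr t Ht). cont. }
    intros e He0. destruct (Cw (e ^ 2) ltac:(nra)) as (a & Ha & Hw).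
    exists (Rmin a (Rmin t (T - t))). split; [repeat apply Rmin_pos; lra|].
    intros x [Hx1 Hx2]; simpl in Hw, Hx2 |- *; unfold R_dist in *.
    assert (Hxa : Rabs (x - t) < a) by (eapply Rlt_le_trans; [exact Hx2|apply Rmin_l]).
    assert (Hx3 : Rabs (x - t) < Rmin t (T - t)) by (eapply Rlt_le_trans; [exact Hx2|apply Rmin_r]).
    assert (Rabs (x - t) < t) by (eapply Rlt_le_trans; [exact Hx3|apply Rmin_l]).
    assert (Rabs (x - t) < T - t) by (eapply Rlt_le_trans; [exact Hx3|apply Rmin_r]).
    assert (Hx : 0 <= x <= T).
    { split; apply Rnot_lt_le; intro; [apply (Rle_not_lt (Rabs (x - t)) t)|apply (Rle_not_lt (Rabs (x - t)) (T - t))];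
      try easy; [generalize (Rle_abs (- (x - t))); rewrite Rabs_Ropp|generalize (Rle_abs (x - t))]; lra. }
    specialize (Hw x (conj Hx1 Hxa)).
    unfold p. rewrite <- Hz in Hw |- *.
    rewrite Rmult_0_l, Rminus_0_r. rewrite !Rmult_0_r, Rplus_0_r, Rminus_0_r in Hw.
    destruct (Rle_lt_or_eq_dec _ _ (Hr0 x Hx)) as [Hp|Hz'].
    + apply Rabs_def2 in Hw; destruct Hw as [Hw _].
      assert (E : (r x * rd x) ^ 2 = 2 * r x + 2 * h * (r x * r x)).
      { replace ((r x * rd x) ^ 2) with (r x ^ 2 * rd x ^ 2) by ring.
        rewrite He by easy. field; lra. }
      assert (h * (r x * r x) <= Rabs h * (r x * r x)).
      { apply Rmult_le_compat_r; [nra|apply Rle_abs]. }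
      assert ((r x * rd x) ^ 2 < e ^ 2) by lra.
      apply Rabs_def1; nra.
    + rewrite <- Hz', Rmult_0_l, Rabs_R0; lra. }
set (s := fun t => p t - p 0 - 2 * h * t).
assert (Cs : forall t, 0 <= t <= T -> continuity_pt s t).
{ intros t Ht; specialize (Cp t Ht). unfold s.
  apply (continuity_pt_minus (fun t => p t - p 0) (fun t => 2 * h * t)); [cont|].
  apply derivable_continuous_pt, ex_derive_Reals_0; auto_derive; easy. }
assert (Dst : forall t, 0 <= t <= T -> 0 < r t -> is_derive s t (/ r t)).
{ intros t Ht Hp. specialize (Dp t Ht Hp). unfold s. derive_using. unfold l; field; lra. }
assert (s0 : s 0 = 0) by (unfold s; ring).
assert (Er : forall t, 0 <= t <= T -> r t = flow0 l (r 0) (p 0) (1 - 4 * l * r 0) (s t)).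
{ intros t Ht. apply (flow_unique l T r s r p (fun t => 1 - 4 * l * r t)); try easy.
  - intros w Hw. specialize (Cr w Hw). cont.
  - refine (punctured_weaken _ _ _ _ _ Hgood). intros w Hw Hp.
    split; [lra|]. split; [now apply Dst|]. split.
    + evar_last; [now apply Dr|]. unfold p; field; lra.
    + split; [now apply Dp|]. specialize (Dr w Hw Hp). derive_using. unfold p; field; lra. }
assert (Et : forall t, 0 <= t <= T -> flow_time l (r 0) (p 0) (s t) = t).
{ apply (flow_time_unique l T r s p); try easy.
  refine (punctured_weaken _ _ _ _ _ Hgood). intros w Hw Hp.
  split; [lra|]. now apply Dst. }
exists (fun i => rd 0 * u i), s.
assert (Edv : dot d (fun i => rd 0 * u i) (fun i => rd 0 * u i) = rd 0 ^ 2).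
{ rewrite (dot_ext d _ _ (fun i => rd 0 * u i + 0 * u i) (fun i => rd 0 * u i + 0 * u i)) by (intros; ring).
  rewrite dot_lin_self, Hu2; ring. }
assert (Ep : dot d (q 0) (fun i => rd 0 * u i) = p 0).
{ rewrite (dot_ext d (q 0) (fun i => rd 0 * u i) (fun i => r 0 * u i + 0 * u i) (fun i => rd 0 * u i + 0 * u i))
    by (intros; rewrite ?Hq by lra; ring).
  rewrite dot_lin, !(dot_comm d u), !dot_lin, Hu2; unfold p; ring. }
assert (El : orb_par d (q 0) (fun i => rd 0 * u i) = l).
{ unfold orb_par. rewrite Edv, Hn, He by lra. unfold l; field; lra. }
intros t Ht. unfold orb_pos, orb_time. rewrite El, Ep, Hn by lra. split; [|now apply Et].
intros i Hi. rewrite !Hq by lra. rewrite (Er t Ht) at 1. unfold flow0.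
replace (1 - 4 * l * r 0) with (r 0 * rd 0 ^ 2 - 1) by (rewrite He by lra; unfold l; field; lra).
unfold p; field; lra.
Qed.

Lemma arc_follows_orbit d A B T q : 0 < vnorm d A -> 0 < vnorm d B ->
  ArcFromTo d A B T q -> exists v s, follows_orbit d A v T q s.
Proof.
intros HA HB ((HT & Hk) & H0 & H1).
assert (E0 : q 0 = A) by (now apply functional_extensionality).
assert (E1 : q T = B) by (now apply functional_extensionality).
subst A B. destruct Hk as [Hk|Hk];
  [now apply regular_follows_orbit|now apply rectilinear_follows_orbit].
Qed.

(** * Geometry of an orbit through its starting point *)

Lemma osc_vol_rel l s : 4 * l * osc_vol l s = s - osc_cos l s * osc_sin l s.
Proof.
unfold osc_vol; destruct (total_order_T l 0) as [[H|H]|H]; try (field; lra).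
unfold osc_cos, osc_sin; destruct (total_order_T l 0) as [[H'|H']|H']; try lra.
subst; ring.
Qed.

(** Passes from the whole fictitious time to half of it. Comparing derivatives avoids a case
    distinction on [l]. *)
Lemma osc_vol_double l s :
  osc_vol l (2 * s) = osc_cos l s * osc_sin l s ^ 3 + 2 * osc_vol l s.
Proof.
set (f := fun s => osc_vol l (2 * s) - (osc_cos l s * osc_sin l s ^ 3 + 2 * osc_vol l s)).
assert (D : forall x, is_derive f x 0).
{ intros x. unfold f.
  assert (D2 := is_derive_comp_R (osc_vol l) (fun s => 2 * s) x _ 2 (is_derive_osc_vol l (2 * x))
    ltac:(auto_derive; [easy|ring])).
  generalize (is_derive_osc_vol l x) (is_derive_osc_sin l x) (is_derive_osc_cos l x); intros.
  set (g := fun s => osc_vol l (2 * s)) in *.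
  change (is_derive (fun s => g s - (osc_cos l s * osc_sin l s ^ 3 + 2 * osc_vol l s)) x 0).
  derive_using. replace (2 * x) with (x + x) by ring. rewrite osc_sin_plus.
  generalize (osc_pythagoras l x); intro E.
  transitivity (osc_sin l x ^ 2 * (osc_cos l x ^ 2 + l * osc_sin l x ^ 2 - 1)); [field|].
  rewrite E; ring. }
assert (E : f s = f 0).
{ apply constant_of_derive_0; intros; [apply D|apply (is_derive_continuity_pt _ _ _ (D x))]. }
unfold f in E. rewrite Rmult_0_r, osc_vol_0, osc_sin_0 in E. lra.
Qed.

(** The last hypothesis is the chord relation. With [D = osc_sin l h] one has
    [osc_cos l (2 h) = 1 - 2 th] and [osc_sin l (2 h) ^ 2 / 2 = 2 D^2 (1 - th)], so it can be solved
    for [D^2]; [subperiod] makes [D] and [osc_cos l h] the positive square roots. *)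
Lemma arc_time_osc m k l h :
  0 < h -> subperiod l (2 * h) ->
  m - 2 * k * osc_cos l (2 * h) = osc_sin l (2 * h) ^ 2 / 2 ->
  let th := l * osc_sin l h ^ 2 in
  th < 1 /\ half_sin (m + 2 * k) (m - 2 * k) th = osc_sin l h /\
  arc_time (m + 2 * k) (m - 2 * k) th = k * osc_sin l (2 * h) + osc_vol l (2 * h).
Proof.
intros Hh Hp E th.
assert (HS : 0 < osc_sin l h).
{ apply osc_sin_pos; [intros Hl; specialize (Hp Hl); lra|easy]. }
assert (HC : 0 < osc_cos l h) by (apply osc_cos_pos; [easy|lra]).
assert (Hi := arc_int_osc l h Hh Hp). fold th in Hi.
assert (Ep := osc_pythagoras l h).
rewrite osc_vol_double.
replace (2 * h) with (h + h) in E by ring. rewrite osc_cos_plus, osc_sin_plus in E.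
replace (2 * h) with (h + h) by ring. rewrite osc_sin_plus.
set (c := osc_cos l h) in *. set (x := osc_sin l h) in *.
assert (Eth : 1 - th = c ^ 2) by (unfold th; lra).
assert (Hth : th < 1) by nra.
assert (Ex : 2 * x ^ 2 * c ^ 2 = m - 2 * k + 4 * k * th).
{ replace th with (1 - c ^ 2) by lra.
  replace (l * x * x) with (1 - c ^ 2) in E by (unfold th in *; lra). lra. }
assert (Eh : half_sin (m + 2 * k) (m - 2 * k) th = x).
{ unfold half_sin. rewrite Eth.
  replace ((m - 2 * k + (m + 2 * k) * th / c ^ 2) / 2) with (Rsqr x).
  - apply sqrt_Rsqr; lra.
  - unfold Rsqr. replace th with (1 - c ^ 2) in * by lra. field_simplify_eq; [|lra]. lra. }
split; [easy|]. split; [easy|]. unfold arc_time. rewrite Eh, Eth, Hi.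
replace (c ^ 2) with (Rsqr c) by (unfold Rsqr; ring). rewrite sqrt_Rsqr by lra.
replace th with (1 - c ^ 2) in Ex by lra.
(* The [osc_vol] terms cancel; what is left is the chord relation [Ex] again. *)
enough ((m + 2 * k) * x / (2 * c) = k * (x * c + c * x) + c * x ^ 3) by lra.
field_simplify_eq; [|lra].
replace m with (2 * x ^ 2 * c ^ 2 + 2 * k - 4 * k * (1 - c ^ 2)) by lra. ring.
Qed.

(** * Algebraic identities along an orbit, in fictitious time *)

Section Orbit.
Variables (d : nat) (A v : Vec).
Hypothesis A_pos : 0 < vnorm d A.

Let r0 := vnorm d A.
Let p0 := dot d A v.
Let l := orb_par d A v.
Let C := osc_cos l.
Let S := osc_sin l.

(* The scalar product of the Levi-Civita square roots of [A] and of [orb_pos d A v s]. *)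
Definition orb_k (s : R) : R :=
  vnorm d A * osc_cos (orb_par d A v) s + dot d A v * osc_sin (orb_par d A v) s / 2.

Lemma dot_vel : dot d v v = 2 / r0 - 4 * l.
Proof. unfold l, orb_par; fold r0; field. unfold r0; lra. Qed.

Lemma orb_pos_lin s i :
  orb_pos d A v s i = (1 - S s ^ 2 / (2 * r0)) * A i + (S s * orb_k s) * v i.
Proof.
unfold orb_pos, flow0, orb_k. fold l r0 p0; fold (C s) (S s). field. unfold r0; lra.
Qed.

(** Lagrange's identity for the square roots [a] of [A] and [z] of the position: [|a|^2 |z|^2] is
    the square of [a.z] plus the square of their determinant. The factor [r0^2 |v|^2 - p0^2] is the
    squared angular momentum, zero exactly when [v] is parallel to [A]. *)
Lemma orb_rad_k s :
  r0 * orb_rad d A v s = orb_k s ^ 2 + (r0 ^ 2 * dot d v v - p0 ^ 2) / 4 * S s ^ 2.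
Proof.
rewrite dot_vel. unfold orb_rad, flow0, orb_k. fold l r0 p0; fold (C s) (S s).
assert (E : C s ^ 2 = 1 - l * S s ^ 2) by (generalize (osc_pythagoras l s); unfold C, S; lra).
assert (0 < r0) by easy.
field_simplify_eq; [|lra].
replace (C s ^ 2) with (1 - l * S s ^ 2). ring.
Qed.

Lemma vel_gram : 0 <= r0 ^ 2 * dot d v v - p0 ^ 2.
Proof.
generalize (cauchy_schwarz d A v); rewrite <- (vnorm_sqr d A); fold r0 p0; lra.
Qed.

Lemma orb_rad_nonneg s : 0 <= orb_rad d A v s.
Proof.
assert (0 <= r0 * orb_rad d A v s).
{ rewrite orb_rad_k. generalize vel_gram (pow2_ge_0 (orb_k s)) (pow2_ge_0 (S s)); nra. }
assert (0 < r0) by easy. nra.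
Qed.

Lemma dot_orb_pos s : dot d (orb_pos d A v s) (orb_pos d A v s) = orb_rad d A v s ^ 2.
Proof.
rewrite (dot_ext d _ _ (fun i => (1 - S s ^ 2 / (2 * r0)) * A i + (S s * orb_k s) * v i)
  (fun i => (1 - S s ^ 2 / (2 * r0)) * A i + (S s * orb_k s) * v i))
  by (intros; apply orb_pos_lin).
rewrite dot_lin_self, <- (vnorm_sqr d A), dot_vel.
unfold orb_rad, flow0, orb_k. fold l r0 p0; fold (C s) (S s).
assert (E : C s ^ 2 = 1 - l * S s ^ 2) by (generalize (osc_pythagoras l s); unfold C, S; lra).
assert (0 < r0) by easy.
field_simplify_eq; [|lra].
replace (C s ^ 4) with ((1 - l * S s ^ 2) ^ 2) by (rewrite <- E; ring).
replace (C s ^ 3) with ((1 - l * S s ^ 2) * C s) by (rewrite <- E; ring).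
replace (C s ^ 2) with (1 - l * S s ^ 2). ring.
Qed.

Lemma vnorm_orb_pos s : vnorm d (orb_pos d A v s) = orb_rad d A v s.
Proof. apply vnorm_unique; [apply orb_rad_nonneg|apply dot_orb_pos]. Qed.

(** Half-angle formula: [orb_k] is [|a| |z|] times the cosine of half the angle from [A] to the
    position. *)
Lemma orb_k_sqr s : 2 * orb_k s ^ 2 = r0 * orb_rad d A v s + dot d A (orb_pos d A v s).
Proof.
rewrite dot_comm, (dot_ext d _ A (fun i => (1 - S s ^ 2 / (2 * r0)) * A i + (S s * orb_k s) * v i) A)
  by (intros; try apply orb_pos_lin; easy).
rewrite dot_lin, <- (vnorm_sqr d A), (dot_comm d v A), orb_rad_k, dot_vel.
unfold orb_k. fold l r0 p0; fold (C s) (S s).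
assert (E : C s ^ 2 = 1 - l * S s ^ 2) by (generalize (osc_pythagoras l s); unfold C, S; lra).
assert (0 < r0) by easy.
field_simplify_eq; [|lra].
replace (C s ^ 2) with (1 - l * S s ^ 2). ring.
Qed.

(** The chord relation, that is, the oscillator energy at the start expressed through both ends of
    the arc. *)
Lemma orb_chord s :
  r0 + orb_rad d A v s - 2 * orb_k s * C s = S s ^ 2 / 2.
Proof.
unfold orb_rad, flow0, orb_k. fold l r0 p0; fold (C s) (S s).
assert (E : C s ^ 2 = 1 - l * S s ^ 2) by (generalize (osc_pythagoras l s); unfold C, S; lra).
field_simplify_eq.
replace (C s ^ 2) with (1 - l * S s ^ 2). ring.
Qed.

(** Recovers the initial velocity from the end point when [S s] and [orb_k s] are nonzero. Where
    [orb_k s = 0], it says instead that the position is a nonpositive multiple of [A]. *)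
Lemma orb_vel s i : S s * r0 * orb_k s * v i =
  orb_rad d A v s * A i + r0 * orb_pos d A v s i - 2 * orb_k s * C s * A i.
Proof.
rewrite orb_pos_lin.
replace (orb_rad d A v s) with (S s ^ 2 / 2 - r0 + 2 * orb_k s * C s)
  by (generalize (orb_chord s); lra).
assert (0 < r0) by easy. field; lra.
Qed.

(** Given [s], the travel time depends on the initial velocity only through [l] and [k]. *)
Lemma orb_time_k s : orb_time d A v s = orb_k s * S s + osc_vol l s.
Proof.
unfold orb_time, flow_time, orb_k. fold l r0 p0; fold (C s) (S s).
generalize (osc_vol_rel l s); fold (C s) (S s); intro.
replace ((1 - 4 * l * r0) * osc_vol l s) with (osc_vol l s - r0 * (4 * l * osc_vol l s)) by ring.
rewrite H; field.
Qed.

Lemma orb_rad_acc s : flow2 l p0 (1 - 4 * l * r0) s = 1 - 4 * l * orb_rad d A v s.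
Proof.
unfold orb_rad, flow0, flow2. fold l r0 p0; fold (C s) (S s).
assert (E : C s ^ 2 = 1 - l * S s ^ 2) by (generalize (osc_pythagoras l s); unfold C, S; lra).
field_simplify_eq.
replace (C s ^ 2) with (1 - l * S s ^ 2). ring.
Qed.

(** Newton's equation after the change [dt = r ds]: [r q'' - r' q' = - q]. *)
Lemma orb_newton s i :
  orb_rad d A v s * flow2 l (r0 * v i) (p0 * v i - A i / r0) s =
  flow1 l p0 (1 - 4 * l * r0) s * flow1 l (r0 * v i) (p0 * v i - A i / r0) s - orb_pos d A v s i.
Proof.
unfold orb_pos, orb_rad, flow0, flow1, flow2. fold l r0 p0; fold (C s) (S s).
assert (E : C s ^ 2 = 1 - l * S s ^ 2) by (generalize (osc_pythagoras l s); unfold C, S; lra).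
assert (0 < r0) by easy.
field_simplify_eq; [|lra].
replace (C s ^ 4) with ((1 - l * S s ^ 2) ^ 2) by (rewrite <- E; ring).
replace (C s ^ 3) with ((1 - l * S s ^ 2) * C s) by (rewrite <- E; ring).
replace (C s ^ 2) with (1 - l * S s ^ 2). ring.
Qed.

(** Radial energy equation; the last term is the squared angular momentum, so in rectilinear motion
    [r'] vanishes at every collision. *)
Lemma orb_energy s :
  flow1 l p0 (1 - 4 * l * r0) s ^ 2 =
  2 * orb_rad d A v s - 4 * l * orb_rad d A v s ^ 2 - (r0 ^ 2 * dot d v v - p0 ^ 2).
Proof.
rewrite dot_vel.
unfold orb_rad, flow0, flow1. fold l r0 p0; fold (C s) (S s).
assert (E : C s ^ 2 = 1 - l * S s ^ 2) by (generalize (osc_pythagoras l s); unfold C, S; lra).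
assert (0 < r0) by easy.
field_simplify_eq; [|lra].
replace (C s ^ 4) with ((1 - l * S s ^ 2) ^ 2) by (rewrite <- E; ring).
replace (C s ^ 3) with ((1 - l * S s ^ 2) * C s) by (rewrite <- E; ring).
replace (C s ^ 2) with (1 - l * S s ^ 2). ring.
Qed.

Lemma is_derive_orb_time s : is_derive (orb_time d A v) s (orb_rad d A v s).
Proof. apply is_derive_flow_time. Qed.

Lemma is_derive_orb_rad s :
  is_derive (orb_rad d A v) s (flow1 l p0 (1 - 4 * l * r0) s).
Proof. apply is_derive_flow0. Qed.

Lemma orb_time_le s1 s2 : s1 <= s2 -> orb_time d A v s1 <= orb_time d A v s2.
Proof.
intros H.
destruct (MVT_gen (orb_time d A v) s1 s2 (orb_rad d A v)) as (c & _ & E).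
- intros; apply is_derive_orb_time.
- intros; apply (is_derive_continuity_pt _ _ _ (is_derive_orb_time x)).
- generalize (orb_rad_nonneg c); nra.
Qed.

(* A zero of the radius is a minimum where its second derivative is [1], so the radius
   cannot vanish on an interval. *)
Lemma orb_time_lt s1 s2 : s1 < s2 -> orb_time d A v s1 < orb_time d A v s2.
Proof.
intros H. destruct (Rle_lt_or_eq_dec _ _ (orb_time_le s1 s2 ltac:(lra))) as [Hl|E]; [easy|].
exfalso.
assert (Dnull : forall (f g : R -> R), (forall s, s1 < s < s2 -> f s = 0) ->
  (forall s, is_derive f s (g s)) -> forall s, s1 < s < s2 -> g s = 0).
{ intros f g Hf Hg s Hs. rewrite <- (is_derive_unique _ _ _ (Hg s)).
  rewrite <- (Derive_const 0 s). apply Derive_ext_loc.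
  exists (mkposreal (Rmin (s - s1) (s2 - s)) ltac:(apply Rmin_pos; lra)).
  intros y Hy. apply Hf. unfold ball in Hy; simpl in Hy; unfold AbsRing_ball, abs, minus, plus, opp in Hy; simpl in Hy.
  assert (Rabs (y + - s) < s - s1) by (eapply Rlt_le_trans; [exact Hy|apply Rmin_l]).
  assert (Rabs (y + - s) < s2 - s) by (eapply Rlt_le_trans; [exact Hy|apply Rmin_r]).
  apply Rabs_def2 in H0; apply Rabs_def2 in H1; lra. }
assert (H0 : forall s, s1 < s < s2 -> orb_time d A v s - orb_time d A v s1 = 0).
{ intros s Hs. generalize (orb_time_le s1 s ltac:(lra)) (orb_time_le s s2 ltac:(lra)); lra. }
assert (H1 := Dnull _ (orb_rad d A v) H0 ltac:(intros s; generalize (is_derive_orb_time s); intro; derive_using; ring)).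
assert (H2 := Dnull _ _ H1 is_derive_orb_rad).
assert (H3 := Dnull _ _ H2 (fun s => is_derive_flow1 l p0 (1 - 4 * l * r0) s) ((s1 + s2) / 2) ltac:(lra)).
rewrite orb_rad_acc, H1 in H3; lra.
Qed.

Lemma orb_time_0 : orb_time d A v 0 = 0.
Proof. unfold orb_time, flow_time; rewrite osc_sin_0, osc_vol_0; field. Qed.

Lemma orb_time_lt_inv s1 s2 : orb_time d A v s1 < orb_time d A v s2 -> s1 < s2.
Proof. intros H; apply Rnot_le_lt; intro Hc; apply orb_time_le in Hc; lra. Qed.

Lemma orb_time_le_inv s1 s2 : orb_time d A v s1 <= orb_time d A v s2 -> s1 <= s2.
Proof. intros H; apply Rnot_lt_le; intro Hc; apply orb_time_lt in Hc; lra. Qed.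

Lemma orb_time_inj s1 s2 : orb_time d A v s1 = orb_time d A v s2 -> s1 = s2.
Proof. intros H; apply Rle_antisym; apply orb_time_le_inv; lra. Qed.

End Orbit.

(** * Direct, indirect and multi-revolution arcs; uniqueness *)

Lemma arc_in_space d T q : KeplerArc d 0 T q -> forall t, 0 <= t <= T -> InSpace d (q t).
Proof.
intros [_ [[v H]|(u & r & rd & h & Hu & _ & H)]] t Ht; [apply (H t Ht)|].
intros i Hi. destruct (H t Ht) as [E _]. rewrite E, (Hu i Hi); ring.
Qed.

Lemma follows_orbit_at d A v T q s s1 : 0 < vnorm d A -> follows_orbit d A v T q s ->
  0 <= orb_time d A v s1 <= T -> s (orb_time d A v s1) = s1.
Proof.
intros HA Hf Ht. apply (orb_time_inj d A v HA). now apply Hf.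
Qed.

(** [orb_k] starts at [|A| > 0], so it vanishes somewhere up to [s1]. By [orb_vel] the position
    there is [- mu A] with [mu >= 0], and [O] lies on the segment from [A] to it. *)
Lemma orb_k_nonpos_indirect d A v T q s s1 :
  0 < vnorm d A -> InSpace d A -> follows_orbit d A v T q s ->
  (forall t, 0 <= t <= T -> InSpace d (q t)) -> veq (q 0) A ->
  0 <= s1 -> orb_time d A v s1 <= T -> orb_k d A v s1 <= 0 -> HullContainsO d 0 T q.
Proof.
intros HA HAs Hf Hs H0 Hs1 HT Hk.
assert (Ck : forall x, continuity_pt (fun x => - orb_k d A v x) x).
{ intros x. apply derivable_continuous_pt, ex_derive_Reals_0.
  generalize (is_derive_osc_cos (orb_par d A v) x) (is_derive_osc_sin (orb_par d A v) x); intros.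
  unfold orb_k. eexists; derive_using; reflexivity. }
assert (Hk0 : orb_k d A v 0 = vnorm d A).
{ unfold orb_k; rewrite osc_cos_0, osc_sin_0; field. }
assert (Hx : exists x, 0 <= x <= s1 /\ orb_k d A v x = 0).
{ destruct Hk as [Hk|Hk]; [|exists s1; lra].
  destruct (Req_dec s1 0) as [E|E]; [rewrite E in Hk; lra|].
  destruct (Ranalysis5.IVT_interv (fun x => - orb_k d A v x) 0 s1) as (x & Hx & E1); try lra.
  - intros; apply Ck.
  - exists x; split; lra. }
destruct Hx as (x & Hx & Ex).
assert (Ht : 0 <= orb_time d A v x <= T).
{ rewrite <- (orb_time_0 d A v) at 1.
  split; [|apply Rle_trans with (2 := HT)]; apply orb_time_le; lra. }
set (t := orb_time d A v x) in *.
set (mu := orb_rad d A v x / vnorm d A).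
assert (Hmu : 0 <= mu) by (apply Rdiv_le_0_compat; [now apply orb_rad_nonneg|easy]).
assert (Eq : forall i, q t i = - mu * A i).
{ intros i. destruct (Nat.lt_ge_cases i d) as [Hi|Hi].
  - destruct (Hf t Ht) as [E _]. rewrite E by easy.
    unfold t; rewrite (follows_orbit_at d A v T q s x) by easy.
    generalize (orb_vel d A v HA x i); rewrite Ex; intro.
    unfold mu; field_simplify_eq; lra.
  - rewrite (Hs t Ht i Hi), (HAs i Hi); ring. }
exists 2%nat, (fun k => match k with O => mu / (1 + mu) | _ => / (1 + mu) end),
  (fun k => match k with O => 0 | _ => t end).
split; [|split].
- intros k Hk'. destruct k as [|k].
  + split; [apply Rdiv_le_0_compat; lra|lra].
  + split; [left; apply Rinv_0_lt_compat; lra|easy].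
- simpl. field; lra.
- intros i; simpl. rewrite H0, Eq. field; lra.
Qed.

(** A convex combination of points of the cone spanned by [A] and [B], apex removed, is [a A + b B]
    with [a, b >= 0] and [a + b > 0]; if it were [O], division by [a + b] would put [O] on the
    segment from [A] to [B]. *)
Lemma cone_direct d A B T q (alpha beta : R -> R) :
  (forall l, 0 <= l <= 1 -> ~ veq (fun i => (1 - l) * A i + l * B i) (fun _ => 0)) ->
  (forall t, 0 <= t <= T -> 0 <= alpha t /\ 0 <= beta t /\ 0 < alpha t + beta t /\
     forall i, q t i = alpha t * A i + beta t * B i) ->
  Direct d 0 T q.
Proof.
intros Hseg H (n & w & tau & Hw & Hw1 & Hw0).
set (a := vsum n (fun k => w k * alpha (tau k))).
set (b := vsum n (fun k => w k * beta (tau k))).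
assert (Ha : 0 <= a).
{ apply vsum_nonneg; intros k Hk. destruct (Hw k Hk) as [? Ht]. apply H in Ht. nra. }
assert (Hb : 0 <= b).
{ apply vsum_nonneg; intros k Hk. destruct (Hw k Hk) as [? Ht]. apply H in Ht. nra. }
assert (Hab : 0 < a + b).
{ apply Rnot_le_lt; intro Hc.
  assert (E : vsum n (fun k => w k * (alpha (tau k) + beta (tau k))) = 0).
  { transitivity (1 * a + 1 * b); [|lra]. unfold a, b; rewrite <- vsum_lin.
    apply vsum_ext; intros; ring. }
  assert (Hz : forall k, (k < n)%nat -> w k = 0).
  { intros k Hk. assert (E1 : w k * (alpha (tau k) + beta (tau k)) = 0).
    { apply (vsum_nonneg_0 n (fun k => w k * (alpha (tau k) + beta (tau k)))); try easy.
      intros j Hj. destruct (Hw j Hj) as [? Ht]. apply H in Ht. nra. }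
    destruct (Hw k Hk) as [? Ht]. apply H in Ht. nra. }
  rewrite (vsum_ext n w (fun k => 0 * w k + 0 * w k)) in Hw1 by (intros k Hk; rewrite (Hz k Hk); ring).
  rewrite vsum_lin in Hw1; lra. }
apply (Hseg (b / (a + b))).
- split; [apply Rdiv_le_0_compat; lra|]. apply Rle_div_l; lra.
- intros i. specialize (Hw0 i).
  rewrite (vsum_ext n _ (fun k => A i * (w k * alpha (tau k)) + B i * (w k * beta (tau k)))) in Hw0.
  + rewrite vsum_lin in Hw0. fold a b in Hw0. field_simplify_eq; lra.
  + intros k Hk. destruct (Hw k Hk) as [_ Ht]. apply H in Ht.
    destruct Ht as (_ & _ & _ & E). rewrite E; ring.
Qed.

Lemma subperiod_le l s1 s2 : s1 <= s2 -> subperiod l s2 -> subperiod l s1.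
Proof. intros H Hp Hl; specialize (Hp Hl); lra. Qed.

(* Writing [q = z^2], [z] is a combination of the square roots of [A] and [B] with
   nonnegative coefficients [osc_sin l (sf - s)] and [osc_sin l s] (up to a common factor). *)
Lemma orb_k_pos_direct d A B v T q s sf :
  0 < vnorm d A -> InSpace d A -> InSpace d B ->
  (forall l, 0 <= l <= 1 -> ~ veq (fun i => (1 - l) * A i + l * B i) (fun _ => 0)) ->
  follows_orbit d A v T q s ->
  (forall t, 0 <= t <= T -> InSpace d (q t)) ->
  0 < sf -> orb_time d A v sf = T -> (forall i, (i < d)%nat -> orb_pos d A v sf i = B i) ->
  subperiod (orb_par d A v) sf -> 0 < orb_k d A v sf -> Direct d 0 T q.
Proof.
intros HA HAs HBs Hseg Hf Hq Hsf HT HB Hp Hk.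
set (l := orb_par d A v) in *. set (r0 := vnorm d A) in *. set (p0 := dot d A v).
set (g := osc_sin l sf). set (c := osc_cos l sf). set (k := orb_k d A v sf) in *.
set (rB := orb_rad d A v sf).
assert (Hg : 0 < g) by now apply osc_sin_pos.
assert (HrB : 0 <= rB) by now apply orb_rad_nonneg.
set (x1 := fun t => osc_sin l (sf - s t)). set (y := fun t => osc_sin l (s t)).
(* These coefficients come from squaring [z = (x1 a + y b) / g], where the cross term is
   [2 a b = (|B| A + |A| B) / k]. *)
apply (cone_direct d A B T q
  (fun t => (x1 t ^ 2 + rB * x1 t * y t / k) / g ^ 2)
  (fun t => (y t ^ 2 + r0 * x1 t * y t / k) / g ^ 2)); [easy|].
intros t Ht.
assert (Hst : 0 <= s t <= sf).
{ destruct (Hf t Ht) as [_ E]. split; apply (orb_time_le_inv d A v HA); rewrite E, ?HT, ?orb_time_0; lra. }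
assert (Hg2 : 0 < g ^ 2) by (now apply pow_lt).
assert (Hx1 : 0 <= x1 t).
{ destruct (Req_dec (s t) sf) as [E|E].
  - unfold x1; rewrite E, Rminus_diag, osc_sin_0; lra.
  - left; apply osc_sin_pos; [|lra]. apply subperiod_le with sf; [lra|easy]. }
assert (Hy : 0 <= y t).
{ destruct (Req_dec (s t) 0) as [E|E].
  - unfold y; rewrite E, osc_sin_0; lra.
  - left; apply osc_sin_pos; [|lra]. apply subperiod_le with sf; [lra|easy]. }
assert (Hxy : 0 < x1 t \/ 0 < y t).
{ destruct (Rlt_dec 0 (s t)) as [H|H].
  - right; apply osc_sin_pos; [|lra]. apply subperiod_le with sf; [lra|easy].
  - left; apply osc_sin_pos; [|lra]. apply subperiod_le with sf; [lra|easy]. }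
assert (Hm : 0 <= x1 t * y t) by nra.
assert (H1 : 0 <= rB * x1 t * y t / k) by (apply Rdiv_le_0_compat; nra).
assert (H2 : 0 <= r0 * x1 t * y t / k) by (apply Rdiv_le_0_compat; nra).
assert (H3 : 0 <= x1 t ^ 2) by apply pow2_ge_0.
assert (H4 : 0 <= y t ^ 2) by apply pow2_ge_0.
assert (H5 : 0 < x1 t ^ 2 + y t ^ 2).
{ destruct Hxy as [H|H]; apply (pow_lt _ 2) in H; lra. }
split; [apply Rdiv_le_0_compat; lra|].
split; [apply Rdiv_le_0_compat; lra|].
split; [rewrite <- Rdiv_plus_distr; apply Rdiv_lt_0_compat; lra|].
intros i. destruct (Nat.lt_ge_cases i d) as [Hi|Hi].
2:{ rewrite (Hq t Ht i Hi), (HAs i Hi), (HBs i Hi); ring. }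
destruct (Hf t Ht) as [E _]. rewrite (E i Hi), orb_pos_lin by easy.
assert (Ev := orb_vel d A v HA sf i). rewrite (HB i Hi) in Ev.
assert (Ec := orb_chord d A v sf).
fold l r0 in Ev, Ec |- *. fold g c k rB in Ev, Ec. fold (y t).
assert (Ex : x1 t = g * osc_cos l (s t) - c * y t) by (unfold x1; now rewrite osc_sin_minus).
assert (Ek : orb_k d A v (s t) = (r0 * x1 t + k * y t) / g).
{ rewrite Ex. unfold k, orb_k. fold l r0 p0 g c (y t). field; lra. }
(* The analogue for every [l] of [sin^2 X + 2 cos (X + Y) sin X sin Y + sin^2 Y = sin^2 (X + Y)];
   the claim reduces to it once [v] is eliminated. *)
assert (P1 : x1 t ^ 2 + 2 * c * x1 t * y t + y t ^ 2 = g ^ 2).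
{ rewrite Ex.
  generalize (osc_pythagoras l sf) (osc_pythagoras l (s t)); fold c g (y t); intros P1 P2.
  transitivity (g ^ 2 * osc_cos l (s t) ^ 2 + y t ^ 2 * (1 - c ^ 2)); [ring|].
  replace (1 - c ^ 2) with (l * g ^ 2) by lra.
  transitivity (g ^ 2 * (osc_cos l (s t) ^ 2 + l * y t ^ 2)); [ring|].
  rewrite P2; ring. }
assert (Hr0 : 0 < r0) by easy.
replace (v i) with ((rB * A i + r0 * B i - 2 * k * c * A i) / (g * r0 * k))
  by (rewrite <- Ev; field; lra).
rewrite Ek.
replace rB with (g ^ 2 / 2 - r0 + 2 * k * c) by lra.
enough (A i * (x1 t ^ 2 + 2 * c * x1 t * y t + y t ^ 2 - g ^ 2) = 0) as E0.
2:{ rewrite P1; ring. }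
apply Rminus_diag_uniq.
transitivity (- (A i * (x1 t ^ 2 + 2 * c * x1 t * y t + y t ^ 2 - g ^ 2)) / g ^ 2).
- field; lra.
- rewrite E0; field; lra.
Qed.

Lemma flow0_half_period l x0 x1 x2 s : 0 < l ->
  flow0 l x0 x1 x2 (s + PI / sqrt l) = flow0 l x0 x1 x2 s.
Proof.
intros Hl; destruct (osc_half_period _ Hl) as [E1 E2]. unfold flow0.
rewrite osc_cos_plus, osc_sin_plus, E1, E2. field.
Qed.

Lemma orb_time_half_period d A v s : 0 < orb_par d A v ->
  orb_time d A v (s + PI / sqrt (orb_par d A v)) =
  orb_time d A v s + orb_time d A v (PI / sqrt (orb_par d A v)).
Proof.
intros Hl; destruct (osc_half_period _ Hl) as [E1 E2]. unfold orb_time, flow_time.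
rewrite osc_vol_half_period, osc_sin_plus, E1, E2 by easy. set (x := PI / sqrt (orb_par d A v)). field.
Qed.

Lemma orb_k_half_period d A v : 0 < orb_par d A v ->
  orb_k d A v (PI / sqrt (orb_par d A v)) = - vnorm d A.
Proof.
intros Hl; destruct (osc_half_period _ Hl) as [E1 E2]. unfold orb_k; rewrite E1, E2; field.
Qed.

Lemma PI_div_sqrt_pos l : 0 < l -> 0 < PI / sqrt l.
Proof. intros Hl; apply Rdiv_lt_0_compat; [apply PI_RGT_0|now apply sqrt_lt_R0]. Qed.

(** After [PI / sqrt l] the square root [z] has become [- z]: the position repeats, and
    [orb_k = - |A|] there shows that the hull contains [O]. *)
Lemma long_arc_multirev d A v T q s sf :
  0 < vnorm d A -> InSpace d A -> follows_orbit d A v T q s ->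
  (forall t, 0 <= t <= T -> InSpace d (q t)) -> veq (q 0) A ->
  orb_time d A v sf = T -> 0 < orb_par d A v -> PI / sqrt (orb_par d A v) < sf ->
  MultiRevolution d 0 T q.
Proof.
intros HA HAs Hf Hq H0 HT Hl Hsf.
set (sp := PI / sqrt (orb_par d A v)) in *.
assert (Hsp : 0 < sp) by now apply PI_div_sqrt_pos.
assert (HP0 : 0 < orb_time d A v sp).
{ rewrite <- (orb_time_0 d A v). now apply orb_time_lt. }
assert (HPT : orb_time d A v sp < T) by (rewrite <- HT; now apply orb_time_lt).
split.
- apply (orb_k_nonpos_indirect d A v T q s sp); try easy; try lra.
  unfold sp; rewrite orb_k_half_period by easy; lra.
- exists (orb_time d A v sp). split; [lra|]. intros t Ht1 Ht2 i.
  destruct (Nat.lt_ge_cases i d) as [Hi|Hi]; [|rewrite !Hq by (easy || lra); easy].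
  destruct (Hf t ltac:(lra)) as [E1 E2].
  destruct (Hf (t + orb_time d A v sp) ltac:(lra)) as [E3 E4].
  rewrite E1, E3 by easy.
  replace (s (t + orb_time d A v sp)) with (s t + sp).
  + now apply flow0_half_period.
  + apply (orb_time_inj d A v HA). rewrite E4. unfold sp at 1.
    rewrite orb_time_half_period by easy. now rewrite E2.
Qed.

(** The squared norm of [|B| A + |A| B] is [2 |A| |B| (|A| |B| + A.B)]. Were the last factor
    nonpositive, this vector would vanish, and division by [|A| + |B|] would put [O] on the
    segment. *)
Lemma off_segment_dot d A B : InSpace d A -> InSpace d B -> 0 < vnorm d A -> 0 < vnorm d B ->
  (forall l, 0 <= l <= 1 -> ~ veq (fun i => (1 - l) * A i + l * B i) (fun _ => 0)) ->
  0 < vnorm d A * vnorm d B + dot d A B.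
Proof.
intros HAs HBs HA HB Hseg. set (a := vnorm d A) in *. set (b := vnorm d B) in *.
apply Rnot_le_lt; intro Hc.
set (w := fun i => b * A i + a * B i).
assert (Ew : dot d w w = 0).
{ apply Rle_antisym; [|apply dot_self_nonneg]. unfold w; rewrite dot_lin_self, <- !vnorm_sqr. fold a b.
  replace (b ^ 2 * a ^ 2 + 2 * b * a * dot d A B + a ^ 2 * b ^ 2)
    with (2 * (a * b) * (a * b + dot d A B)) by ring.
  assert (0 < a * b) by nra. nra. }
apply (Hseg (a / (a + b))).
- split; [apply Rdiv_le_0_compat; lra|]. apply Rle_div_l; lra.
- intros i. assert (E : w i = 0).
  { destruct (Nat.lt_ge_cases i d) as [Hi|Hi]; [now apply (dot_self_0 d)|].
    unfold w; rewrite (HAs i Hi), (HBs i Hi); ring. }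
  unfold w in E. field_simplify_eq; lra.
Qed.

(* Both signs of [k] are covered: [(m + 2 k) (m - 2 k)] is the squared length of the chord. *)
Lemma chord_pos d A B k : InSpace d A -> InSpace d B -> 0 < vnorm d A -> 0 < vnorm d B -> ~ veq A B ->
  2 * k ^ 2 = vnorm d A * vnorm d B + dot d A B ->
  0 < vnorm d A + vnorm d B + 2 * k /\ 0 < vnorm d A + vnorm d B - 2 * k.
Proof.
intros HAs HBs HA HB Hne Hk.
set (w := fun i => 1 * A i + -1 * B i).
assert (Hw : 0 < dot d w w).
{ destruct (Rle_lt_or_eq_dec _ _ (dot_self_nonneg d w)) as [H|H]; [easy|].
  exfalso; apply Hne; intro i. destruct (Nat.lt_ge_cases i d) as [Hi|Hi].
  - assert (w i = 0) by (now apply (dot_self_0 d)). unfold w in *; lra.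
  - now rewrite (HAs i Hi), (HBs i Hi). }
unfold w in Hw; rewrite dot_lin_self, <- !vnorm_sqr in Hw.
set (a := vnorm d A) in *; set (b := vnorm d B) in *.
assert (0 < (a + b + 2 * k) * (a + b - 2 * k)) by nra.
split; apply Rnot_le_lt; intro; nra.
Qed.

Record normal_arc d A B T q v s sf : Prop := {
  na_follows : follows_orbit d A v T q s;
  na_pos : 0 < sf;
  na_time : orb_time d A v sf = T;
  na_end : forall i, (i < d)%nat -> orb_pos d A v sf i = B i;
  na_sub : subperiod (orb_par d A v) sf }.

Section Uniqueness.
Variables (d : nat) (A B : Vec) (T : R).
Hypotheses (HAs : InSpace d A) (HBs : InSpace d B) (HA : 0 < vnorm d A) (HB : 0 < vnorm d B)
  (Hne : ~ veq A B)
  (Hseg : forall l, 0 <= l <= 1 -> ~ veq (fun i => (1 - l) * A i + l * B i) (fun _ => 0))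
  (HT : 0 < T).

Lemma normal_arc_rad q v s sf : normal_arc d A B T q v s sf -> orb_rad d A v sf = vnorm d B.
Proof.
intros []. rewrite <- vnorm_orb_pos by easy. rewrite !vnorm_dot; f_equal; now apply dot_ext.
Qed.

Lemma normal_arc_k q v s sf : normal_arc d A B T q v s sf ->
  2 * orb_k d A v sf ^ 2 = vnorm d A * vnorm d B + dot d A B.
Proof.
intros H. rewrite orb_k_sqr, (normal_arc_rad _ _ _ _ H) by easy.
f_equal. apply dot_ext; [easy|apply H].
Qed.

(** More than one period gives a multi-revolution arc, hence neither a direct nor a simple indirect
    one, and exactly one period would end at [A]. The sign of [k] then separates the two kinds;
    [k = 0] is impossible because [O] is off the segment. *)
Lemma arc_normal q : ArcFromTo d A B T q -> Direct d 0 T q \/ SimpleIndirect d 0 T q ->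
  exists v s sf, normal_arc d A B T q v s sf /\
    (Direct d 0 T q -> 0 < orb_k d A v sf) /\ (SimpleIndirect d 0 T q -> orb_k d A v sf < 0).
Proof.
intros Hq Hds. destruct (arc_follows_orbit d A B T q HA HB Hq) as (v & s & Hf).
destruct Hq as (Harc & H0 & H1). assert (Hqs := arc_in_space d T q Harc).
destruct (Hf T ltac:(lra)) as [E1 E2].
assert (Hsf : 0 < s T).
{ apply (orb_time_lt_inv d A v HA). rewrite E2, orb_time_0; lra. }
assert (Hend : forall i, (i < d)%nat -> orb_pos d A v (s T) i = B i).
{ intros i Hi; rewrite <- E1 by easy. apply H1. }
assert (Hsub : subperiod (orb_par d A v) (s T)).
{ intros Hl. apply Rnot_le_lt; intros [Hc|Hc].
  - assert (HM : MultiRevolution d 0 T q)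
      by (apply (long_arc_multirev d A v T q s (s T)); easy).
    destruct Hds as [Hd|[_ Hd]]; [apply Hd, HM|now apply Hd].
  - apply Hne; intros i. destruct (Nat.lt_ge_cases i d) as [Hi|Hi].
    + rewrite <- Hend, <- Hc by easy. rewrite <- (Rplus_0_l (PI / _)).
      unfold orb_pos; rewrite flow0_half_period by easy.
      unfold flow0; rewrite osc_sin_0; field. lra.
    + now rewrite (HAs i Hi), (HBs i Hi). }
assert (Hn : normal_arc d A B T q v s (s T)) by (now constructor).
exists v, s, (s T). split; [easy|].
assert (Hk2 := normal_arc_k _ _ _ _ Hn).
assert (Hpos := off_segment_dot d A B HAs HBs HA HB Hseg).
split.
- intros Hd. apply Rnot_le_lt; intro Hc. apply Hd.
  apply (orb_k_nonpos_indirect d A v T q s (s T)); try easy; lra.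
- intros [Hi _]. apply Rnot_le_lt; intros [Hc|Hc].
  + now apply (orb_k_pos_direct d A B v T q s (s T)).
  + rewrite <- Hc in Hk2. lra.
Qed.

Lemma normal_arc_theta q v s sf (h := sf / 2) (l := orb_par d A v) (k := orb_k d A v sf)
  (m := vnorm d A + vnorm d B) (th := l * osc_sin l h ^ 2) :
  normal_arc d A B T q v s sf ->
  0 < osc_sin l h /\ 0 < osc_cos l h /\ th < 1 /\
  half_sin (m + 2 * k) (m - 2 * k) th = osc_sin l h /\
  arc_time (m + 2 * k) (m - 2 * k) th = T.
Proof.
intros Hn. assert (Hr := normal_arc_rad _ _ _ _ Hn). destruct Hn as [Hf Hp Ht He Hs].
assert (E : sf = 2 * h) by (unfold h; field).
assert (Hh : 0 < h) by (unfold h; lra).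
fold l in Hs. assert (Hs2 : subperiod l (2 * h)) by now rewrite <- E.
split; [apply osc_sin_pos; [apply subperiod_le with (2 * h); [lra|easy]|easy]|].
split; [apply osc_cos_pos; [easy|lra]|].
destruct (arc_time_osc m k l h Hh Hs2) as (H1 & H2 & H3).
- rewrite <- E. unfold m; rewrite <- Hr. apply orb_chord.
- split; [easy|]. split; [easy|]. unfold th. rewrite H3, <- E, <- Ht. now rewrite orb_time_k.
Qed.

(** The squares of the two [k] agree, so equal signs make them equal, and strict monotonicity of the
    time gives the same [th]. As [D = half_sin th] and [th = l D^2], also [D] and [l] agree, hence
    [osc_sin] and [osc_cos] at the end, hence the initial velocities by [orb_vel]. *)
Lemma normal_arc_unique q1 v1 s1 sf1 q2 v2 s2 sf2 :
  normal_arc d A B T q1 v1 s1 sf1 -> normal_arc d A B T q2 v2 s2 sf2 ->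
  0 < orb_k d A v1 sf1 * orb_k d A v2 sf2 ->
  forall t i, 0 <= t <= T -> (i < d)%nat -> q1 t i = q2 t i.
Proof.
intros N1 N2 Hk.
assert (K1 := normal_arc_k _ _ _ _ N1). assert (K2 := normal_arc_k _ _ _ _ N2).
assert (R1 := normal_arc_rad _ _ _ _ N1). assert (R2 := normal_arc_rad _ _ _ _ N2).
assert (Ek : orb_k d A v2 sf2 = orb_k d A v1 sf1).
{ assert (E : (orb_k d A v2 sf2 - orb_k d A v1 sf1) * (orb_k d A v2 sf2 + orb_k d A v1 sf1) = 0) by nra.
  apply Rmult_integral in E; destruct E as [E|E]; [lra|].
  replace (orb_k d A v2 sf2) with (- orb_k d A v1 sf1) in Hk by lra. nra. }
destruct (normal_arc_theta _ _ _ _ N1) as (S1 & C1 & T1 & H1 & F1).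
destruct (normal_arc_theta _ _ _ _ N2) as (S2 & C2 & T2 & H2 & F2).
destruct (chord_pos d A B _ HAs HBs HA HB Hne K1) as [Hmu Hnu].
rewrite Ek in H2, F2.
assert (Eth : orb_par d A v1 * osc_sin (orb_par d A v1) (sf1 / 2) ^ 2 =
              orb_par d A v2 * osc_sin (orb_par d A v2) (sf2 / 2) ^ 2).
{ match goal with |- ?x = ?y => destruct (Rtotal_order x y) as [Hl|[He|Hl]] end; [exfalso|easy|exfalso].
  - assert (HH := arc_time_lt _ (vnorm d A + vnorm d B - 2 * orb_k d A v1 sf1) _ _ Hmu Hl T2).
    rewrite F1, F2, H1 in HH; specialize (HH S1); lra.
  - assert (HH := arc_time_lt _ (vnorm d A + vnorm d B - 2 * orb_k d A v1 sf1) _ _ Hmu Hl T1).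
    rewrite F1, F2, H2 in HH; specialize (HH S2); lra. }
rewrite <- Eth, H1 in H2.
assert (El : orb_par d A v1 = orb_par d A v2).
{ rewrite <- H2 in Eth. assert (0 < osc_sin (orb_par d A v1) (sf1 / 2) ^ 2) by (now apply pow_lt).
  now apply Rmult_eq_reg_r in Eth; [|lra]. }
rewrite <- El in *.
(* Equal squares suffice, since both cosines are positive by [C1] and [C2]. *)
assert (Ec : osc_cos (orb_par d A v1) (sf1 / 2) = osc_cos (orb_par d A v1) (sf2 / 2)).
{ generalize (osc_pythagoras (orb_par d A v1) (sf1 / 2)) (osc_pythagoras (orb_par d A v1) (sf2 / 2)).
  rewrite <- H2; intros. nra. }
assert (Es : osc_sin (orb_par d A v1) sf1 = osc_sin (orb_par d A v1) sf2 /\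
             osc_cos (orb_par d A v1) sf1 = osc_cos (orb_par d A v1) sf2).
{ replace sf1 with (sf1 / 2 + sf1 / 2) by field. replace sf2 with (sf2 / 2 + sf2 / 2) by field.
  now rewrite !osc_sin_plus, !osc_cos_plus, <- H2, <- Ec. }
destruct Es as [Es Ec'].
assert (Hg : 0 < osc_sin (orb_par d A v1) sf1) by (apply osc_sin_pos; apply N1).
assert (Ev : forall i, (i < d)%nat -> v1 i = v2 i).
{ intros i Hi.
  assert (V1 := orb_vel d A v1 HA sf1 i). assert (V2 := orb_vel d A v2 HA sf2 i).
  rewrite (na_end _ _ _ _ _ _ _ _ N1 i Hi), R1 in V1.
  rewrite (na_end _ _ _ _ _ _ _ _ N2 i Hi), R2, Ek, <- El, <- Es, <- Ec' in V2.
  rewrite <- V2 in V1. apply Rmult_eq_reg_l in V1; [easy|].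
  repeat apply Rmult_integral_contrapositive_currified; try lra.
  intro Z; rewrite Z in Hk; lra. }
assert (Ed : dot d A v1 = dot d A v2) by (now apply dot_ext).
intros t i Ht Hi.
destruct (na_follows _ _ _ _ _ _ _ _ N1 t Ht) as [Q1 U1].
destruct (na_follows _ _ _ _ _ _ _ _ N2 t Ht) as [Q2 U2].
rewrite Q1, Q2 by easy.
assert (E : s1 t = s2 t).
{ apply (orb_time_inj d A v1 HA). rewrite U1, <- U2 at 1. unfold orb_time. now rewrite El, Ed. }
unfold orb_pos. now rewrite E, Ed, (Ev i Hi), El.
Qed.

Lemma arc_unique q1 q2 : ArcFromTo d A B T q1 -> ArcFromTo d A B T q2 ->
  (Direct d 0 T q1 /\ Direct d 0 T q2) \/ (SimpleIndirect d 0 T q1 /\ SimpleIndirect d 0 T q2) ->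
  forall t, 0 <= t <= T -> veq (q1 t) (q2 t).
Proof.
intros Q1 Q2 H t Ht i.
destruct (Nat.lt_ge_cases i d) as [Hi|Hi].
2:{ rewrite (arc_in_space d T q1 (proj1 Q1) t Ht i Hi).
    now rewrite (arc_in_space d T q2 (proj1 Q2) t Ht i Hi). }
destruct (arc_normal q1 Q1 ltac:(tauto)) as (v1 & s1 & sf1 & N1 & D1 & I1).
destruct (arc_normal q2 Q2 ltac:(tauto)) as (v2 & s2 & sf2 & N2 & D2 & I2).
apply (normal_arc_unique q1 v1 s1 sf1 q2 v2 s2 sf2); try easy.
destruct H as [[P1 P2]|[P1 P2]].
- specialize (D1 P1); specialize (D2 P2); nra.
- specialize (I1 P1); specialize (I2 P2); nra.
Qed.
End Uniqueness.

(** * Existence *)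

Lemma flow1_plus l y z s h : flow1 l y z (s + h) = flow1 l (flow1 l y z s) (flow2 l y z s) h.
Proof. unfold flow1, flow2. rewrite osc_cos_plus, osc_sin_plus. ring. Qed.

Lemma flow2_plus l y z s h : flow2 l y z (s + h) = flow2 l (flow1 l y z s) (flow2 l y z s) h.
Proof. unfold flow1, flow2. rewrite osc_cos_plus, osc_sin_plus. ring. Qed.

(** The flow on [(y, z)] minus the identity has determinant [4 l osc_sin^2], nonzero for [l <> 0].
    For [l = 0] the flow is a shear fixing exactly the vectors [(y, 0)]. *)
Lemma flow_fixed l y z h : 0 < osc_sin l h -> flow1 l y z h = y -> flow2 l y z h = z ->
  z = 0 /\ (l <> 0 -> y = 0).
Proof.
unfold flow1, flow2. intros HS.
assert (E := osc_pythagoras l h). set (x := osc_cos l h) in *. set (w := osc_sin l h) in *.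
intros E1 E2.
assert (F1 : w * (z * x - 2 * l * w * y) = 0).
{ replace (x ^ 2 - l * w ^ 2) with (1 - 2 * (l * w ^ 2)) in E1 by lra. lra. }
assert (F2 : w * (l * (w * z + 2 * x * y)) = 0).
{ replace (x ^ 2 - l * w ^ 2) with (1 - 2 * (l * w ^ 2)) in E2 by lra. lra. }
apply Rmult_integral in F1; destruct F1 as [F1|F1]; [lra|].
apply Rmult_integral in F2; destruct F2 as [F2|F2]; [lra|].
destruct (Req_dec l 0) as [Hl|Hl].
- split; [|easy]. rewrite Hl in *. assert (x <> 0) by (intro Hx; rewrite Hx in E; lra).
  assert (z * x = 0) by lra. apply Rmult_integral in H0; tauto.
- apply Rmult_integral in F2; destruct F2 as [F2|F2]; [easy|].
  assert (Hy : y = 0).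
  { assert (w * (z * x - 2 * l * w * y) = 0) by (rewrite F1; ring).
    assert (x * (w * z + 2 * x * y) = 0) by (rewrite F2; ring).
    assert (y * (x ^ 2 + l * w ^ 2) = 0) by lra. rewrite E in *; lra. }
  split; [|easy]. rewrite Hy in F2. assert (w * z = 0) by lra.
  apply Rmult_integral in H; destruct H; [lra|easy].
Qed.

(** An inverse of [orb_time], differentiable only off collisions, where [orb_time] has zero
    derivative. *)
Definition orb_clock d A v (t : R) : R := epsilon (inhabits 0) (fun s => orb_time d A v s = t).

(** * Orbits as arcs in physical time *)

Section Clock.
Variables (d : nat) (A v : Vec) (sf : R).
Hypothesis HA : 0 < vnorm d A.
Hypothesis Hsf : 0 < sf.

Let T := orb_time d A v sf.
Let clock := orb_clock d A v.
(** The margins on both sides make [0, T] interior to the range where the clock inverts [orb_time],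
    so that two-sided limits make sense at the ends. *)
Let a := orb_time d A v (- 1).
Let b := orb_time d A v (sf + 1).

Lemma orb_clock_spec t : a < t < b -> orb_time d A v (clock t) = t.
Proof.
intros Ht. apply (epsilon_spec (inhabits 0) (fun s => orb_time d A v s = t)).
destruct (IVT_gen (orb_time d A v) (-1) (sf + 1) t) as (x & _ & E); [| |now exists x].
- intros x; apply (is_derive_continuity_pt _ _ _ (is_derive_orb_time d A v x)).
- fold a b. rewrite Rmin_left, Rmax_right; lra.
Qed.

Lemma orb_clock_dom t : 0 <= t <= T -> a < t < b.
Proof.
intros Ht. assert (a < 0) by (rewrite <- (orb_time_0 d A v); apply orb_time_lt; lra).
assert (T < b) by (apply orb_time_lt; lra). lra.
Qed.

Lemma orb_clock_time s : 0 <= s <= sf -> clock (orb_time d A v s) = s.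
Proof.
intros Hs. apply (orb_time_inj d A v HA), orb_clock_spec, orb_clock_dom.
rewrite <- (orb_time_0 d A v) at 1. split; apply orb_time_le; lra.
Qed.

Lemma continuity_pt_orb_clock t : 0 <= t <= T -> continuity_pt clock t.
Proof.
intros Ht e He. assert (Hd := orb_clock_dom t Ht).
assert (E := orb_clock_spec t Hd).
assert (H1 : orb_time d A v (clock t - e) < t) by (rewrite <- E at 2; apply orb_time_lt; lra).
assert (H2 : t < orb_time d A v (clock t + e)) by (rewrite <- E at 1; apply orb_time_lt; lra).
set (t1 := orb_time d A v (clock t - e)) in *. set (t2 := orb_time d A v (clock t + e)) in *.
exists (Rmin (Rmin (t - a) (b - t)) (Rmin (t - t1) (t2 - t))).
split; [repeat apply Rmin_pos; lra|].
intros u [_ Hu]; simpl in Hu |- *; unfold R_dist in *.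
assert (B1 : Rabs (u - t) < Rmin (t - a) (b - t)) by (eapply Rlt_le_trans; [exact Hu|apply Rmin_l]).
assert (B2 : Rabs (u - t) < Rmin (t - t1) (t2 - t)) by (eapply Rlt_le_trans; [exact Hu|apply Rmin_r]).
assert (B3 : Rabs (u - t) < t - a) by (eapply Rlt_le_trans; [exact B1|apply Rmin_l]).
assert (B4 : Rabs (u - t) < b - t) by (eapply Rlt_le_trans; [exact B1|apply Rmin_r]).
assert (B5 : Rabs (u - t) < t - t1) by (eapply Rlt_le_trans; [exact B2|apply Rmin_l]).
assert (B6 : Rabs (u - t) < t2 - t) by (eapply Rlt_le_trans; [exact B2|apply Rmin_r]).
apply Rabs_def2 in B3, B4, B5, B6.
assert (Eu := orb_clock_spec u ltac:(lra)).
assert (clock t - e < clock u) by (apply (orb_time_lt_inv d A v HA); rewrite Eu; fold t1; lra).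
assert (clock u < clock t + e) by (apply (orb_time_lt_inv d A v HA); rewrite Eu; fold t2; lra).
apply Rabs_def1; lra.
Qed.

Lemma is_derive_orb_clock t : 0 <= t <= T -> 0 < orb_rad d A v (clock t) ->
  is_derive clock t (/ orb_rad d A v (clock t)).
Proof.
intros Ht Hr. assert (Hd := orb_clock_dom t Ht).
assert (E := orb_clock_spec t Hd).
assert (D := is_derive_orb_time d A v (clock t)). apply is_derive_Reals in D.
apply is_derive_Reals. intros e He.
set (r := orb_rad d A v (clock t)) in *.
(* The first tolerance keeps the difference quotient [Q] of [orb_time] above [r / 2]; then
   [|1/Q - 1/r| <= 2 |Q - r| / r^2], which the second makes smaller than [e]. *)
destruct (D (Rmin (r / 2) (e * (r * r) / 2))) as (dl & HD).
{ apply Rmin_pos; [lra|]. assert (0 < r * r) by nra. nra. }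
destruct (continuity_pt_orb_clock t Ht dl (cond_pos dl)) as (dc & Hdc & HC).
assert (Hdl : 0 < Rmin dc (Rmin (t - a) (b - t))) by (repeat apply Rmin_pos; lra).
exists (mkposreal _ Hdl). intros w Hw0 Hw; simpl in Hw.
assert (W1 : Rabs w < dc) by (eapply Rlt_le_trans; [exact Hw|apply Rmin_l]).
assert (W : Rabs w < Rmin (t - a) (b - t)) by (eapply Rlt_le_trans; [exact Hw|apply Rmin_r]).
assert (W2 : Rabs w < t - a) by (eapply Rlt_le_trans; [exact W|apply Rmin_l]).
assert (W3 : Rabs w < b - t) by (eapply Rlt_le_trans; [exact W|apply Rmin_r]).
apply Rabs_def2 in W2, W3.
assert (Ew := orb_clock_spec (t + w) ltac:(lra)).
specialize (HC (t + w)). simpl in HC; unfold R_dist, D_x, no_cond in HC.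
assert (HC' : Rabs (clock (t + w) - clock t) < dl).
{ apply HC. repeat split; [lra|]. now replace (t + w - t) with w by ring. }
set (x := clock (t + w) - clock t) in *.
assert (Hx : x <> 0).
{ intro Hx. assert (Hc : clock (t + w) = clock t) by (unfold x in Hx; lra).
  rewrite Hc, E in Ew; lra. }
specialize (HD x Hx HC').
replace (clock t + x) with (clock (t + w)) in HD by (unfold x; ring).
rewrite Ew, E in HD. replace (t + w - t) with w in HD by ring.
set (Q := w / x) in *.
assert (HD1 : Rabs (Q - r) < r / 2) by (eapply Rlt_le_trans; [exact HD|apply Rmin_l]).
assert (HD2 : Rabs (Q - r) < e * (r * r) / 2) by (eapply Rlt_le_trans; [exact HD|apply Rmin_r]).
apply Rabs_def2 in HD1.
assert (HQ : 0 < Q) by lra.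
replace (x / w - / r) with (- ((Q - r) / (Q * r))) by (unfold Q; field; repeat split; lra).
rewrite Rabs_Ropp. unfold Rdiv; rewrite Rabs_mult.
assert (HQr : 0 < Q * r) by nra.
rewrite (Rabs_pos_eq (/ (Q * r))) by (left; now apply Rinv_0_lt_compat).
apply Rlt_div_l; [easy|]. apply Rlt_le_trans with (1 := HD2).
assert (r * r / 2 <= Q * r) by nra. nra.
Qed.

Lemma orb_clock_follows : follows_orbit d A v T (fun t => orb_pos d A v (clock t)) clock.
Proof.
intros t Ht; split; [easy|]. now apply orb_clock_spec, orb_clock_dom.
Qed.

Lemma orb_pos_in_space s : InSpace d A -> InSpace d v -> InSpace d (orb_pos d A v s).
Proof.
intros H1 H2 i Hi. rewrite orb_pos_lin, (H1 i Hi), (H2 i Hi) by easy. ring.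
Qed.

Lemma is_derive_flow0_clock x0 x1 x2 t (l := orb_par d A v) :
  0 <= t <= T -> 0 < orb_rad d A v (clock t) ->
  is_derive (fun t => flow0 l x0 x1 x2 (clock t)) t
    (flow1 l x1 x2 (clock t) / orb_rad d A v (clock t)).
Proof.
intros Ht Hr. apply (is_derive_comp_R (flow0 l x0 x1 x2) clock); [apply is_derive_flow0|].
now apply is_derive_orb_clock.
Qed.

Lemma is_derive_flow1_clock x1 x2 t (l := orb_par d A v) :
  0 <= t <= T -> 0 < orb_rad d A v (clock t) ->
  is_derive (fun t => flow1 l x1 x2 (clock t)) t
    (flow2 l x1 x2 (clock t) / orb_rad d A v (clock t)).
Proof.
intros Ht Hr. apply (is_derive_comp_R (flow1 l x1 x2) clock); [apply is_derive_flow1|].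
now apply is_derive_orb_clock.
Qed.

Lemma orb_arc_regular : InSpace d A -> InSpace d v -> (forall s, 0 < orb_rad d A v s) ->
  KeplerRegular d 0 T (fun t => orb_pos d A v (clock t)).
Proof.
intros HAs Hvs Hr. set (l := orb_par d A v).
exists (fun t i => flow1 l (vnorm d A * v i) (dot d A v * v i - A i / vnorm d A) (clock t)
  / orb_rad d A v (clock t)).
intros t Ht. split; [now apply orb_pos_in_space|].
rewrite vnorm_orb_pos by easy. split; [apply Rgt_not_eq, Hr|].
intros i Hi; split; apply is_derive_Reals.
- now apply is_derive_flow0_clock.
- assert (D1 := is_derive_flow1_clock (vnorm d A * v i) (dot d A v * v i - A i / vnorm d A) t Ht (Hr _)).
  assert (D2 := is_derive_flow0_clock (vnorm d A) (dot d A v) (1 - 4 * l * vnorm d A) t Ht (Hr _)).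
  assert (E := orb_newton d A v HA (clock t) i).
  fold l in D1, D2, E. specialize (Hr (clock t)).
  change (fun t => flow0 l (vnorm d A) (dot d A v) (1 - 4 * l * vnorm d A) (clock t))
    with (fun t => orb_rad d A v (clock t)) in D2.
  pose (f := fun t => flow1 l (vnorm d A * v i) (dot d A v * v i - A i / vnorm d A) (clock t)).
  pose (r := fun t => orb_rad d A v (clock t)).
  change (is_derive f t (flow2 l (vnorm d A * v i) (dot d A v * v i - A i / vnorm d A) (clock t) / r t)) in D1.
  change (is_derive r t (flow1 l (dot d A v) (1 - 4 * l * vnorm d A) (clock t) / r t)) in D2.
  change (is_derive (fun t => f t / r t) t (- orb_pos d A v (clock t) i / r t ^ 3)).
  change (0 < r t) in Hr.
  derive_using.
  change (orb_rad d A v (clock t)) with (r t) in E.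
  change (flow1 l (vnorm d A * v i) (dot d A v * v i - A i / vnorm d A) (clock t)) with (f t) in E.
  replace (orb_pos d A v (clock t) i) with
   (flow1 l (dot d A v) (1 - 4 * l * vnorm d A) (clock t) * f t -
    r t * flow2 l (vnorm d A * v i) (dot d A v * v i - A i / vnorm d A) (clock t)) by lra.
  field; lra.
Qed.

(** For [v] parallel to [A] the angular momentum is zero, so [r'^2 = 2 r - 4 l r^2] in fictitious
    time, which is the energy relation with energy [- 2 l]. *)
Lemma orb_arc_rectilinear c : InSpace d A -> (forall i, v i = c * A i) ->
  KeplerRectilinear d 0 T (fun t => orb_pos d A v (clock t)).
Proof.
intros HAs Hv. set (l := orb_par d A v). set (r0 := vnorm d A) in *. set (p0 := dot d A v).
assert (Ep : p0 = c * r0 ^ 2).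
{ unfold p0; rewrite dot_comm, (dot_ext d v A (fun i => c * A i + 0 * A i) A)
    by (intros; rewrite ?Hv; ring).
  rewrite dot_lin, <- vnorm_sqr; fold r0; ring. }
assert (Ev : dot d v v = c ^ 2 * r0 ^ 2).
{ rewrite (dot_ext d v v (fun i => c * A i + 0 * A i) (fun i => c * A i + 0 * A i))
    by (intros; rewrite ?Hv; ring).
  rewrite dot_lin_self, <- vnorm_sqr; fold r0; ring. }
assert (Hr0 : 0 < r0) by easy.
pose (r := fun t => orb_rad d A v (clock t)).
pose (p := fun t => flow1 l p0 (1 - 4 * l * r0) (clock t)).
assert (En : forall s, flow1 l p0 (1 - 4 * l * r0) s ^ 2 =
  2 * orb_rad d A v s - 4 * l * orb_rad d A v s ^ 2).
{ intros s. unfold l, p0, r0. rewrite orb_energy by easy. fold l p0 r0. rewrite Ev, Ep; ring. }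
exists (fun i => A i / r0), r, (fun t => p t / r t), (- 2 * l).
split; [intros i Hi; rewrite (HAs i Hi); unfold Rdiv; ring|]. split.
{ apply vnorm_unique; [lra|].
  rewrite (dot_ext d _ _ (fun i => / r0 * A i + 0 * A i) (fun i => / r0 * A i + 0 * A i))
    by (intros; unfold Rdiv; ring).
  rewrite dot_lin_self, <- vnorm_sqr; fold r0; field; lra. }
intros t Ht. split; [|split; [|split; [|split]]].
- intros i. rewrite orb_pos_lin, Hv by easy. unfold r, orb_rad, flow0, orb_k. fold l r0 p0.
  assert (El : l = (/ r0 - c ^ 2 * r0 ^ 2 / 2) / 2) by (unfold l, orb_par; now rewrite Ev).
  set (x := osc_sin l (clock t)). set (y := osc_cos l (clock t)).
  rewrite Ep, El. field; lra.
- now apply orb_rad_nonneg.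
- apply (continuity_pt_comp clock (orb_rad d A v)); [now apply continuity_pt_orb_clock|].
  apply (is_derive_continuity_pt _ _ _ (is_derive_orb_rad d A v _)).
- intros Hr.
  assert (D1 := is_derive_flow1_clock p0 (1 - 4 * l * r0) t Ht Hr).
  assert (D2 := is_derive_flow0_clock r0 p0 (1 - 4 * l * r0) t Ht Hr).
  assert (E := orb_rad_acc d A v (clock t)). fold l r0 p0 in E, D1, D2. rewrite E in D1.
  change (is_derive p t ((1 - 4 * l * r t) / r t)) in D1.
  change (is_derive r t (p t / r t)) in D2.
  specialize (En (clock t)). change (p t ^ 2 = 2 * r t - 4 * l * r t ^ 2) in En.
  split; [|split].
  + now apply is_derive_Reals.
  + apply is_derive_Reals. derive_using.
    apply Rminus_diag_uniq.
    transitivity ((2 * r t - 4 * l * r t ^ 2 - p t ^ 2) / r t ^ 3); [field; lra|].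
    rewrite En; field; lra.
  + transitivity (p t ^ 2 / (2 * r t ^ 2) - 1 / r t); [field; lra|]. rewrite En; field; lra.
(* In fictitious time [r'] vanishes at every collision and has derivative 1 there; a second
   collision nearby would make its difference quotient 0. *)
- intros Hr. unfold r in Hr.
  assert (Hp0 : flow1 l p0 (1 - 4 * l * r0) (clock t) = 0).
  { specialize (En (clock t)). rewrite Hr in En. nra. }
  assert (D := is_derive_flow1 l p0 (1 - 4 * l * r0) (clock t)).
  apply is_derive_Reals in D.
  assert (E := orb_rad_acc d A v (clock t)). fold l r0 p0 in E. rewrite E, Hr in D.
  destruct (D 1 ltac:(lra)) as (e & He).
  destruct (continuity_pt_orb_clock t Ht e (cond_pos e)) as (e' & He' & Hc).
  exists e'; split; [easy|]. intros u Hu Hut Hru. unfold r in Hru.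
  specialize (Hc u). simpl in Hc; unfold R_dist, D_x, no_cond in Hc.
  assert (Hne : u <> t) by (intro; subst; rewrite Rminus_diag, Rabs_R0 in Hut; lra).
  assert (Hc' : Rabs (clock u - clock t) < e) by (apply Hc; repeat split; [auto|lra]).
  assert (Hx : clock u - clock t <> 0).
  { intro Hx. apply Hne. rewrite <- (orb_clock_spec u), <- (orb_clock_spec t) by now apply orb_clock_dom.
    f_equal; lra. }
  specialize (He _ Hx Hc').
  replace (clock t + (clock u - clock t)) with (clock u) in He by ring.
  assert (Hpu : flow1 l p0 (1 - 4 * l * r0) (clock u) = 0).
  { specialize (En (clock u)). rewrite Hru in En. nra. }
  rewrite Hpu, Hp0 in He.
  replace ((0 - 0) / (clock u - clock t) - (1 - 4 * l * 0)) with (- (1)) in He by (field; easy).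
  rewrite Rabs_Ropp, Rabs_R1 in He; lra.
Qed.

(* If the motion repeats itself, so do velocity and acceleration; in fictitious time these
   evolve by a rotation, which has no nonzero fixed vector before a full period. *)
Lemma short_orbit_not_multirev : subperiod (orb_par d A v) sf ->
  ~ MultiRevolution d 0 T (fun t => orb_pos d A v (clock t)).
Proof.
intros Hsub (_ & P & HP & Hper). set (l := orb_par d A v) in *.
assert (HT : 0 < T) by (unfold T; rewrite <- (orb_time_0 d A v); apply orb_time_lt; lra).
pose (r := fun t => orb_rad d A v (clock t)).
assert (Cr : continuity_pt r 0).
{ apply (continuity_pt_comp clock (orb_rad d A v)); [apply continuity_pt_orb_clock; lra|].
  apply (is_derive_continuity_pt _ _ _ (is_derive_orb_rad d A v _)). }
assert (Hr0 : 0 < r 0).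
{ assert (Ec : clock 0 = 0).
  { rewrite <- (orb_time_0 d A v) at 1. apply orb_clock_time; lra. }
  unfold r; rewrite Ec.
  unfold orb_rad, flow0; rewrite osc_sin_0. lra. }
destruct (continuity_pt_pos_near r 0 Cr Hr0) as (e & He & Hre).
(* A time close to 0, where the radius is still positive, and strictly between 0 and [T - P], so
   that the repetition can be differentiated there. *)
set (t0 := Rmin e (T - P) / 2).
assert (Ht0 : 0 < t0 /\ t0 < e /\ t0 < T - P).
{ assert (Rmin e (T - P) <= e) by apply Rmin_l. assert (Rmin e (T - P) <= T - P) by apply Rmin_r.
  assert (0 < Rmin e (T - P)) by (apply Rmin_pos; lra). unfold t0; lra. }
assert (Hr1 : 0 < r t0) by (apply Hre; rewrite Rminus_0_r, Rabs_pos_eq; lra).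
assert (Err : forall t, 0 <= t -> t + P <= T -> r (t + P) = r t).
{ intros t H1 H2. unfold r. rewrite <- !vnorm_orb_pos by easy. rewrite !vnorm_dot; f_equal.
  apply dot_ext; intros; now apply Hper. }
assert (Hr2 : 0 < r (t0 + P)) by (rewrite Err; lra).
set (x1 := clock t0). set (h := clock (t0 + P) - x1).
assert (Ex2 : clock (t0 + P) = x1 + h) by (unfold h; ring).
assert (E1 := orb_clock_spec t0 (orb_clock_dom t0 ltac:(lra))).
assert (E2 := orb_clock_spec (t0 + P) (orb_clock_dom (t0 + P) ltac:(lra))).
assert (Hh : 0 < h).
{ assert (x1 < clock (t0 + P)) by (apply (orb_time_lt_inv d A v HA); unfold x1; rewrite E1, E2; lra).
  unfold h; lra. }
assert (Hhs : 0 < osc_sin l h).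
{ apply osc_sin_pos; [|easy]. apply subperiod_le with sf; [|easy].
  assert (0 <= x1) by (apply (orb_time_le_inv d A v HA); unfold x1; rewrite E1, orb_time_0; lra).
  assert (clock (t0 + P) <= sf) by (apply (orb_time_le_inv d A v HA); rewrite E2; fold T; lra).
  unfold h; lra. }
assert (Hflow : forall y0 y z, (forall t, 0 <= t -> t + P <= T ->
  flow0 l y0 y z (clock (t + P)) = flow0 l y0 y z (clock t)) ->
  flow1 l y z (x1 + h) = flow1 l y z x1).
{ intros y0 y z Hp.
  assert (D1 := is_derive_flow0_clock y0 y z t0 ltac:(lra) Hr1).
  assert (D2 := is_derive_flow0_clock y0 y z (t0 + P) ltac:(lra) Hr2).
  pose (f := fun t => flow0 l y0 y z (clock t)).
  assert (D3 := is_derive_comp_R f (fun t => t + P) t0 _ 1 D2 ltac:(auto_derive; [easy|ring])).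
  assert (D4 : is_derive (fun t => f (t + P)) t0 (flow1 l y z (clock t0) / orb_rad d A v (clock t0))).
  { apply is_derive_ext_loc with (2 := D1).
    exists (mkposreal (Rmin t0 (T - P - t0)) ltac:(apply Rmin_pos; lra)).
    intros u Hu. unfold ball in Hu; simpl in Hu; unfold AbsRing_ball, abs, minus, plus, opp in Hu; simpl in Hu.
    assert (U1 : Rabs (u + - t0) < t0) by (eapply Rlt_le_trans; [exact Hu|apply Rmin_l]).
    assert (U2 : Rabs (u + - t0) < T - P - t0) by (eapply Rlt_le_trans; [exact Hu|apply Rmin_r]).
    apply Rabs_def2 in U1, U2. symmetry; apply Hp; lra. }
  apply is_derive_unique in D3. apply is_derive_unique in D4. rewrite D3 in D4.
  rewrite <- Ex2.
  change (orb_rad d A v (clock (t0 + P))) with (r (t0 + P)) in D4.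
  change (orb_rad d A v (clock t0)) with (r t0) in D4. rewrite Err in D4 by lra.
  fold x1 in D4. fold l in D4.
  apply (f_equal (fun z => z * r t0)) in D4.
  transitivity (flow1 l y z (clock (t0 + P)) / r t0 * 1 * r t0); [field; lra|].
  rewrite D4; field; lra. }
set (r0 := vnorm d A) in *. set (p0 := dot d A v).
assert (G0 : forall s, flow2 l p0 (1 - 4 * l * r0) s = 1 - 4 * l * orb_rad d A v s)
  by (intros; apply orb_rad_acc).
assert (Er : orb_rad d A v (x1 + h) = orb_rad d A v x1).
{ rewrite <- Ex2. apply Err; lra. }
assert (P1 := Hflow r0 p0 (1 - 4 * l * r0) Err).
(* The derivatives of the radius are fixed by the flow over [h], so [r'' = 0]; as [r'' = 1] when
   [l = 0], this forces [l <> 0] and then [r' = 0]. A circular motion is still possible, so the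
   position itself has to be examined. *)
destruct (flow_fixed l (flow1 l p0 (1 - 4 * l * r0) x1) (flow2 l p0 (1 - 4 * l * r0) x1) h Hhs)
  as [Z1 Z2].
{ now rewrite <- flow1_plus. }
{ now rewrite <- flow2_plus, !G0, Er. }
assert (Hl : l <> 0) by (intro Hl; rewrite G0, Hl in Z1; lra).
specialize (Z2 Hl).
(* As [r' = 0], [orb_newton] reads [r q'' = - q]: so [q''] repeats with [q], and [(q', q'')] is
   fixed by the flow too. Then [q'' = 0] and [q = 0], although the radius is positive. *)
assert (Hq : forall i, (i < d)%nat -> orb_pos d A v x1 i = 0).
{ intros i Hi.
  assert (Pi := Hflow (A i) (r0 * v i) (p0 * v i - A i / r0) (fun t H1 H2 => Hper t H1 H2 i)).
  assert (N1 := orb_newton d A v HA x1 i). assert (N2 := orb_newton d A v HA (x1 + h) i).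
  fold l r0 p0 in N1, N2. rewrite P1, Z2 in N2. rewrite Z2 in N1. rewrite Er in N2.
  assert (Hp : orb_pos d A v (x1 + h) i = orb_pos d A v x1 i).
  { rewrite <- Ex2. apply (Hper t0); lra. }
  rewrite Hp, Rmult_0_l in N2. rewrite Rmult_0_l in N1.
  assert (Hrx : 0 < orb_rad d A v x1) by easy.
  destruct (flow_fixed l (flow1 l (r0 * v i) (p0 * v i - A i / r0) x1)
    (flow2 l (r0 * v i) (p0 * v i - A i / r0) x1) h Hhs) as [Y1 Y2].
  { now rewrite <- flow1_plus. }
  { rewrite <- flow2_plus. apply (Rmult_eq_reg_l (orb_rad d A v x1)); [|lra]. now rewrite N2. }
  rewrite Y1 in N1. lra. }
assert (Hz : orb_rad d A v x1 ^ 2 = 0).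
{ rewrite <- dot_orb_pos by easy.
  rewrite (dot_ext d _ _ (fun _ => 0) (fun _ => 0)) by easy.
  unfold dot. rewrite (vsum_ext d _ (fun i => 0 * 0 + 0 * 0)) by (intros; ring).
  rewrite (vsum_lin d 0 0 (fun _ => 0) (fun _ => 0)); ring. }
assert (0 < orb_rad d A v x1 ^ 2) by (apply pow_lt; exact Hr1). lra.
Qed.

End Clock.

(** [v] is obtained by solving [orb_vel]. The chord relation makes its energy parameter equal to the
    prescribed [l]. *)
Lemma two_point_orbit d A B k l sf (rA := vnorm d A) (rB := vnorm d B)
  (v := fun i => ((rB - 2 * k * osc_cos l sf) * A i + rA * B i) / (osc_sin l sf * rA * k)) :
  0 < rA -> k <> 0 -> osc_sin l sf <> 0 ->
  2 * k ^ 2 = rA * rB + dot d A B ->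
  rA + rB - 2 * k * osc_cos l sf = osc_sin l sf ^ 2 / 2 ->
  orb_par d A v = l /\ orb_k d A v sf = k /\ forall i, orb_pos d A v sf i = B i.
Proof.
intros HA Hk Hs Hk2 Hc.
assert (EP := osc_pythagoras l sf).
set (c := osc_cos l sf) in *. set (g := osc_sin l sf) in *.
set (x := (rB - 2 * k * c) / (g * rA * k)). set (y := / (g * k)).
assert (Ev : forall i, v i = x * A i + y * B i) by (intros; unfold v, x, y; field; lra).
assert (EAB : dot d A B = 2 * k ^ 2 - rA * rB) by lra.
assert (ErB : rB = g ^ 2 / 2 - rA + 2 * k * c) by lra.
assert (Ep : dot d A v = 2 * (k - rA * c) / g).
{ rewrite dot_comm, (dot_ext d v A (fun i => x * A i + y * B i) A) by (intros; try apply Ev; easy).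
  rewrite dot_lin, (dot_comm d B A), EAB, <- vnorm_sqr. fold rA. unfold x, y. field. lra. }
assert (Evv : dot d v v = 2 / rA - 4 * l).
{ rewrite (dot_ext d v v (fun i => x * A i + y * B i) (fun i => x * A i + y * B i))
    by (intros; apply Ev).
  rewrite dot_lin_self, EAB, <- !vnorm_sqr. fold rA rB. unfold x, y.
  replace l with ((1 - c ^ 2) / g ^ 2) by (field_simplify_eq; lra).
  rewrite ErB. field. lra. }
assert (El : orb_par d A v = l).
{ unfold orb_par; rewrite Evv; fold rA; field; lra. }
assert (Ekk : orb_k d A v sf = k).
{ unfold orb_k; rewrite El, Ep; fold rA c g. field; lra. }
split; [easy|]. split; [easy|].
intros i. rewrite orb_pos_lin by easy. rewrite Ekk, El; fold rA c g. rewrite Ev. unfold x, y.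
rewrite ErB. field; lra.
Qed.

(** Runs the time formula backwards: [T] and [k] give [th], then [D = half_sin th], [l = th / D^2],
    the half time [h] with [osc_sin l h = D], and finally [v]. The angular momentum decides between
    a regular and a rectilinear arc. *)
Lemma orbit_arc_exists d A B T k :
  InSpace d A -> InSpace d B -> 0 < vnorm d A -> 0 < vnorm d B -> ~ veq A B -> 0 < T ->
  0 < vnorm d A * vnorm d B + dot d A B -> 2 * k ^ 2 = vnorm d A * vnorm d B + dot d A B ->
  exists q v s sf, ArcFromTo d A B T q /\ normal_arc d A B T q v s sf /\ orb_k d A v sf = k /\
    ~ MultiRevolution d 0 T q.
Proof.
intros HAs HBs HA HB Hne HT Hpos Hk2.
assert (Hk : k <> 0) by (intro Hk; rewrite Hk in Hk2; lra).
destruct (chord_pos d A B k HAs HBs HA HB Hne Hk2) as [Hmu Hnu].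
set (m := vnorm d A + vnorm d B) in *.
destruct (arc_time_surj (m + 2 * k) (m - 2 * k) T Hmu Hnu) as (th & Hth & Hd & Et); [lra|easy|].
set (dl := half_sin (m + 2 * k) (m - 2 * k) th) in *.
assert (Hdl : 0 < dl) by (now apply sqrt_lt_R0).
assert (Edl : dl ^ 2 = (m - 2 * k + (m + 2 * k) * th / (1 - th)) / 2).
{ unfold dl, half_sin; apply pow2_sqrt; lra. }
set (l := th / dl ^ 2).
assert (Hdl2 : 0 < dl ^ 2) by (now apply pow_lt).
assert (Eth : l * dl ^ 2 = th) by (unfold l; field; lra).
destruct (osc_arcsin l dl Hdl ltac:(lra)) as (h & Hh & Hsub & Es).
assert (EP := osc_pythagoras l h). rewrite Es, Eth in EP.
assert (Hc : m - 2 * k * osc_cos l (2 * h) = osc_sin l (2 * h) ^ 2 / 2).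
{ replace (2 * h) with (h + h) by ring. rewrite osc_cos_plus, osc_sin_plus, Es.
  replace (osc_cos l h * osc_cos l h - l * dl * dl) with (1 - 2 * th) by lra.
  replace ((dl * osc_cos l h + osc_cos l h * dl) ^ 2 / 2) with (2 * dl ^ 2 * osc_cos l h ^ 2) by field.
  replace (osc_cos l h ^ 2) with (1 - th) by lra. rewrite Edl; field; lra. }
destruct (arc_time_osc m k l h Hh Hsub Hc) as (_ & _ & ET). rewrite Es, Eth, Et in ET.
set (sf := 2 * h) in *.
assert (Hsf : 0 < sf) by (unfold sf; lra).
assert (Hg : 0 < osc_sin l sf) by (now apply osc_sin_pos).
destruct (two_point_orbit d A B k l sf HA Hk ltac:(lra) Hk2 Hc) as (El & Ek & EB).
set (v := fun i => ((vnorm d B - 2 * k * osc_cos l sf) * A i + vnorm d A * B i)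
  / (osc_sin l sf * vnorm d A * k)) in *.
assert (ETs : orb_time d A v sf = T) by (rewrite orb_time_k, El, Ek; lra).
assert (Hvs : InSpace d v).
{ intros i Hi; unfold v; rewrite (HAs i Hi), (HBs i Hi); unfold Rdiv; ring. }
exists (fun t => orb_pos d A v (orb_clock d A v t)), v, (orb_clock d A v), sf.
assert (Hf := orb_clock_follows d A v sf HA). rewrite ETs in Hf.
split; [split; [split; [easy|]|split]|split; [|split; [easy|]]].
- rewrite <- ETs.
  destruct (Rle_lt_or_eq_dec _ _ (vel_gram d A v)) as [Hg0|Hg0].
  + left. apply orb_arc_regular; try easy. intros s.
    assert (H := orb_rad_k d A v HA s).
    enough (0 < vnorm d A * orb_rad d A v s) by nra. rewrite H.
    (* If [osc_sin] vanishes, then [osc_cos^2 = 1] and [orb_k^2 = |A|^2]; otherwise the angular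
       momentum term is positive. So the orbit never meets [O]. *)
    destruct (Req_dec (osc_sin (orb_par d A v) s) 0) as [Z|Z].
    * assert (P := osc_pythagoras (orb_par d A v) s). unfold orb_k. rewrite Z in P |- *.
      replace ((vnorm d A * osc_cos (orb_par d A v) s + dot d A v * 0 / 2) ^ 2) with
        (vnorm d A ^ 2 * osc_cos (orb_par d A v) s ^ 2) by field.
      replace (osc_cos (orb_par d A v) s ^ 2) with 1 by lra. generalize (pow_lt _ 2 HA); lra.
    * assert (0 < osc_sin (orb_par d A v) s ^ 2) by (apply pow2_gt_0; easy).
      generalize (pow2_ge_0 (orb_k d A v s)); nra.
  + right. set (c := dot d A v / vnorm d A ^ 2).
    apply (orb_arc_rectilinear d A v sf HA c HAs).
    intros i. destruct (Nat.lt_ge_cases i d) as [Hi|Hi]; [|rewrite (HAs i Hi), (Hvs i Hi); ring].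
    (* Equality in the Cauchy-Schwarz inequality makes [v] equal to [c A]. *)
    assert (E0 : dot d (fun i => 1 * v i + - c * A i) (fun i => 1 * v i + - c * A i) = 0).
    { rewrite dot_lin_self, (dot_comm d v A), <- (vnorm_sqr d A).
      transitivity ((vnorm d A ^ 2 * dot d v v - dot d A v ^ 2) / vnorm d A ^ 2);
        [unfold c; field; lra|]. rewrite <- Hg0; field; lra. }
    generalize (dot_self_0 d _ E0 i Hi); lra.
- intros i. replace (orb_clock d A v 0) with 0.
  + unfold orb_pos, flow0; rewrite osc_sin_0; field; lra.
  + symmetry. rewrite <- (orb_time_0 d A v) at 1. apply (orb_clock_time d A v sf); lra.
- intros i. rewrite <- ETs at 1. rewrite (orb_clock_time d A v sf) by lra. apply EB.
- constructor; try easy. now rewrite El.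
- rewrite <- ETs. apply short_orbit_not_multirev; try easy. now rewrite El.
Qed.

Theorem mainTheorem11 (d : nat) (A B : Vec) (T : R) :
  (d = 2%nat \/ d = 3%nat) ->
  InSpace d A -> InSpace d B ->
  ~ veq A (fun _ => 0) -> ~ veq B (fun _ => 0) -> ~ veq A B ->
  (forall l, 0 <= l <= 1 -> ~ veq (fun i => (1 - l) * A i + l * B i) (fun _ => 0)) ->
  0 < T ->
  (exists q, ArcFromTo d A B T q /\ Direct d 0 T q /\
     forall q', ArcFromTo d A B T q' -> Direct d 0 T q' ->
       forall t, 0 <= t <= T -> veq (q' t) (q t)) /\
  (exists q, ArcFromTo d A B T q /\ SimpleIndirect d 0 T q /\
     forall q', ArcFromTo d A B T q' -> SimpleIndirect d 0 T q' ->
       forall t, 0 <= t <= T -> veq (q' t) (q t)).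
Proof.
intros _ HAs HBs HA0 HB0 Hne Hseg HT.
assert (HA := vnorm_pos d A HAs HA0). assert (HB := vnorm_pos d B HBs HB0).
assert (Hpos := off_segment_dot d A B HAs HBs HA HB Hseg).
(* The positive root of the half-angle formula yields the direct arc, its opposite the simple
   indirect one. *)
set (k := sqrt ((vnorm d A * vnorm d B + dot d A B) / 2)).
assert (Hk : 0 < k) by (apply sqrt_lt_R0; lra).
assert (Hk2 : 2 * k ^ 2 = vnorm d A * vnorm d B + dot d A B)
  by (unfold k; rewrite pow2_sqrt; lra).
split.
- destruct (orbit_arc_exists d A B T k HAs HBs HA HB Hne HT Hpos Hk2)
    as (q & v & s & sf & Hq & [Hf H1 H2 H3 H4] & Ek & _).
  assert (HD : Direct d 0 T q).
  { apply (orb_k_pos_direct d A B v T q s sf); try easy.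
    - apply arc_in_space, Hq.
    - now rewrite Ek. }
  exists q; split; [easy|]. split; [easy|].
  intros q' Hq' HD' t Ht. now apply (arc_unique d A B T HAs HBs HA HB Hne Hseg HT); auto.
- destruct (orbit_arc_exists d A B T (- k) HAs HBs HA HB Hne HT Hpos ltac:(lra))
    as (q & v & s & sf & Hq & [Hf H1 H2 H3 H4] & Ek & HM).
  assert (HI : SimpleIndirect d 0 T q).
  { split; [|easy]. apply (orb_k_nonpos_indirect d A v T q s sf); try easy; try lra.
    - apply arc_in_space, Hq.
    - apply Hq. }
  exists q; split; [easy|]. split; [easy|].
  intros q' Hq' HI' t Ht. now apply (arc_unique d A B T HAs HBs HA HB Hne Hseg HT); auto.
Qed.
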